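(* Let $\mathcal H$ be a complex Hilbert space with scalar product $\langle\cdot,\cdot\rangle$ and norm $\|\cdot\|$. Let $\mathfrak a$ be a densely defined, continuous, closed (not necessarily symmetric) sesquilinear form on $\mathcal H$ which is bounded from below, i.e. there is $\eta\in\mathbb R$ with $\operatorname{Re}\mathfrak a(u,u)+\eta\|u\|^2\ge 0$ for all $u\in D(\mathfrak a)$. Let $A$ be the operator associated with $\mathfrak a$, let $\mathfrak h(u,v):=\frac12\big(\mathfrak a(u,v)+\overline{\mathfrak a(v,u)}\big)$ on $D(\mathfrak h)=D(\mathfrak a)$ be the symmetric part of $\mathfrak a$, and let $H$ be the self-adjoint operator associated with $\mathfrak h$. (i) If $H$ has no spectrum in $(-\infty,0)$, then $A$ has no eigenvalue in $\{z\in\mathbb C:\operatorname{Re} z<0\}$. (ii) Assume that the spectrum of $H$ in $(-\infty,0)$ is discrete. Let $\lambda_1,\dots,\lambda_N$ be any finite family of eigenvalues of $A$ with $\operatorname{Re}\lambda_j<0$ for all $j$, where an eigenvalue of algebraic multiplicity $k$ may occur $n$ times in the family with $n\le k$. Then for every $\gamma\ge 1$, $$\sum_{k=1}^N(-\operatorname{Re}\lambda_k)^\gamma\le \operatorname{Tr}(H)_-^\gamma .$$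
   Context: The operator associated with a closed densely defined sectorial form $\mathfrak a$ is the operator $A$ with $D(A)=\{u\in D(\mathfrak a):\exists f\in\mathcal H,\ \mathfrak a(u,v)=\langle f,v\rangle\ \forall v\in D(\mathfrak a)\}$, $Au=f$. The algebraic multiplicity of an eigenvalue $\lambda$ of $A$ is $\sup_{k\in\mathbb N}\dim\ker(\lambda I-A)^k$. ''Discrete spectrum in $(-\infty,0)$'' means the spectrum of $H$ in $(-\infty,0)$ consists of isolated eigenvalues of finite multiplicity. $\operatorname{Tr}(H)_-^\gamma:=\sum_j(-\mu_j)^\gamma$, where $\mu_j$ runs over the negative eigenvalues of $H$ repeated according to multiplicity (this may be $+\infty$). *)

(* Defs.v *)
From HB Require Import structures.
From mathcomp Require Import all_boot all_order all_algebra.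
From mathcomp Require Import all_classical all_reals all_analysis.
From mathcomp Require Import complex.
Set Implicit Arguments. Unset Strict Implicit. Unset Printing Implicit Defensive.
Import Order.TTheory GRing.Theory Num.Theory.
Local Open Scope classical_set_scope.
Local Open Scope ring_scope.

Section HilbertForms.
Variables (R : realType) (V : lmodType R[i]) (ip : V -> V -> R[i]).

Definition hnorm (u : V) : R := Num.sqrt (complex.Re (ip u u)).

Definition is_hilbert : Prop :=
  [/\ (forall (c : R[i]) (u v w : V), ip (c *: u + v) w = c * ip u w + ip v w),
      (forall u v : V, ip u v = conjc (ip v u)),
      (forall u : V, 0 <= complex.Re (ip u u)),
      (forall u : V, ip u u = 0 -> u = 0) &
      (forall s : nat -> V,
         (forall e : R, 0 < e -> exists N, forall n m, (N <= n)%N -> (N <= m)%N ->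
            hnorm (s n - s m) < e) ->
         exists x, forall e : R, 0 < e -> exists N, forall n, (N <= n)%N ->
            hnorm (s n - x) < e)].

Variables (D : set V) (a : V -> V -> R[i]).

Definition is_sesquilinear_form : Prop :=
  [/\ D 0,
      (forall (c : R[i]) u v, D u -> D v -> D (c *: u + v)),
      (forall (c : R[i]) u v w, D u -> D v -> D w ->
          a (c *: u + v) w = c * a u w + a v w) &
      (forall (c : R[i]) u v w, D u -> D v -> D w ->
          a u (c *: v + w) = conjc c * a u v + a u w)].

Definition densely_defined : Prop :=
  forall x : V, forall e : R, 0 < e -> exists2 u, D u & hnorm (x - u) < e.

Definition bounded_below_by (eta : R) : Prop :=
  forall u, D u -> 0 <= complex.Re (a u u) + eta * hnorm u ^+ 2.

Definition fnorm (eta : R) (u : V) : R :=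
  Num.sqrt (complex.Re (a u u) + (1 + eta) * hnorm u ^+ 2).

Definition continuous_form (eta : R) : Prop :=
  exists M : R, forall u v, D u -> D v ->
    ComplexField.Normc.normc (a u v) <= M * fnorm eta u * fnorm eta v.

Definition closed_form (eta : R) : Prop :=
  forall s : nat -> V, (forall n, D (s n)) ->
    (forall e : R, 0 < e -> exists N, forall n m, (N <= n)%N -> (N <= m)%N ->
        fnorm eta (s n - s m) < e) ->
    exists2 x, D x & forall e : R, 0 < e -> exists N, forall n, (N <= n)%N ->
        fnorm eta (s n - x) < e.

(* graph of the operator associated with the form a:  Op u f  <->  u \in D(A), Au = f *)
Definition assoc_op (u f : V) : Prop := D u /\ forall v, D v -> a u v = ip f v.

Definition sym_part (u v : V) : R[i] := (a u v + conjc (a v u)) / 2%:R.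

End HilbertForms.

Section Spectral.
Variables (R : realType) (V : lmodType R[i]) (ip : V -> V -> R[i]).
(* an operator given by its graph *)
Variable Op : V -> V -> Prop.

Definition in_resolvent (z : R[i]) : Prop :=
  [/\ (forall f, exists u g, Op u g /\ z *: u - g = f),
      (forall u g, Op u g -> z *: u - g = 0 -> u = 0) &
      (exists c : R, forall u g, Op u g -> hnorm ip u <= c * hnorm ip (z *: u - g))].

Definition is_eigenvalue (z : R[i]) : Prop :=
  exists u g, u <> 0 /\ Op u g /\ g = z *: u.

Definition shifted (z : R[i]) (u w : V) : Prop := exists g, Op u g /\ w = z *: u - g.

Fixpoint ker_pow (z : R[i]) (k : nat) (u : V) : Prop :=
  match k with
  | 0 => u = 0
  | k'.+1 => exists w, shifted z u w /\ ker_pow z k' w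
  end.

Definition lin_indep (n : nat) (v : 'I_n -> V) : Prop :=
  forall c : 'I_n -> R[i], \sum_(i < n) c i *: v i = 0 -> forall i, c i = 0.

Definition dim_ge (P : V -> Prop) (n : nat) : Prop :=
  exists v : 'I_n -> V, (forall i, P (v i)) /\ lin_indep v.

Definition alg_mult_ge (z : R[i]) (n : nat) : Prop :=
  exists k, dim_ge (ker_pow z k) n.

Definition mult_ereal (z : R[i]) : \bar R :=
  ereal_sup [set (n%:R)%:E | n in [set n | dim_ge (ker_pow z 1) n]].

Definition discrete_neg_spectrum : Prop :=
  forall mu : R, mu < 0 -> ~ in_resolvent (mu%:C)%C ->
    [/\ exists2 e : R, 0 < e & forall z : R[i], z <> (mu%:C)%C -> ComplexField.Normc.normc (z - (mu%:C)%C) < e ->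
           in_resolvent z,
        is_eigenvalue (mu%:C)%C &
        exists n, ~ dim_ge (ker_pow (mu%:C)%C 1) n].

Definition neg_trace (gamma : R) : \bar R :=
  (\esum_(mu in [set mu : R | (mu < 0)%R /\ is_eigenvalue (mu%:C)%C])
     (mult_ereal (mu%:C)%C * (((- mu) `^ gamma)%R)%:E))%E.

End Spectral.

(* Main.v *)
Require Import Defs.
From HB Require Import structures.
From mathcomp Require Import all_boot all_order all_algebra.
From mathcomp Require Import all_classical all_reals all_analysis.
From mathcomp Require Import complex.
From mathcomp Require Import ring lra.
Import Order.TTheory GRing.Theory Num.Theory numFieldNormedType.Exports.
Local Open Scope classical_set_scope.
Local Open Scope ring_scope.

(* Write h for the symmetric part of a.  Restricted to the span of finitely many
   generalised eigenvectors, A has a Schur basis: orthonormal u_1, ..., u_N in D(A)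
   with a(u_k, u_k) = lambda_k, hence h(u_k, u_k) = Re lambda_k.  If e_1, ..., e_n is a
   maximal orthonormal family of eigenvectors of H with eigenvalues mu_i < - eps
   (finite as soon as the trace is), then h >= - eps on its orthogonal complement, so
   - Re lambda_k <= sum_i (- mu_i) |<u_k, e_i>|^2 + eps.  Jensen's inequality, Bessel's
   inequality in k, and eps -> 0 conclude.

   The spectral theorem is avoided.  Suppose the infimum m of the Rayleigh quotient of
   h on that complement is below - eps, and put G = H - m >= 0 there.  As m is an isolated
   point of the spectrum or not in it, |G w|^2 >= c <G w, w> for some c > 0.  Under this
   inequality the iterates of s (G + s)^-1, applied to a vector with small Rayleigh
   quotient of G, converge geometrically in the form norm to a nonzero vector of ker G,
   which contradicts the maximality of the family. *)

(** * Positive semidefinite real forms and geometric sequences in their seminorms *)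

Section RealForms.
Set Implicit Arguments. Unset Strict Implicit.
Variables (R : realType) (V : lmodType R[i]).

Definition subspace (D : set V) : Prop :=
  D 0 /\ forall (c : R[i]) u v, D u -> D v -> D (c *: u + v).

Lemma subspaceZ D c u : subspace D -> D u -> D (c *: u).
Proof. by move=> [D0 DZ] Du; rewrite -[_ *: _]addr0; exact: DZ. Qed.

Lemma subspaceD D u v : subspace D -> D u -> D v -> D (u + v).
Proof. by move=> [_ DZ] Du Dv; rewrite -[u]scale1r; exact: DZ. Qed.

Lemma subspaceB D u v : subspace D -> D u -> D v -> D (u - v).
Proof. by move=> sD Du Dv; rewrite -scaleN1r addrC; case: sD => _; apply. Qed.

Lemma subspace_sum D n (f : 'I_n -> V) :
  subspace D -> (forall i, D (f i)) -> D (\sum_i f i).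
Proof.
move=> sD Df; apply: big_ind => //; first by case: sD.
by move=> x y; exact: subspaceD.
Qed.

(** Homogeneity is asked for real scalars only, so that real parts of Hermitian forms on a complex
    space are instances. *)
Definition psd_on (D : set V) (q : V -> V -> R) : Prop :=
  [/\ forall u v w, D u -> D v -> D w -> q (u + v) w = q u w + q v w,
      forall (c : R) u v, D u -> D v -> q (c%:C%C *: u) v = c * q u v,
      forall u v, D u -> D v -> q u v = q v u &
      forall u, D u -> 0 <= q u u].

Variables (D : set V) (q : V -> V -> R).
Hypotheses (sD : subspace D) (qP : psd_on D q).

Lemma psdDl u v w : D u -> D v -> D w -> q (u + v) w = q u w + q v w.
Proof. by case: qP => + _ _ _; apply. Qed.

Lemma psdC u v : D u -> D v -> q u v = q v u.
Proof. by case: qP => _ _ + _; apply. Qed.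

Lemma psdDr u v w : D u -> D v -> D w -> q w (u + v) = q w u + q w v.
Proof.
by move=> *; rewrite psdC ?psdDl ?(psdC (u := w))//; exact: subspaceD.
Qed.

Lemma psdZl c u v : D u -> D v -> q (c%:C%C *: u) v = c * q u v.
Proof. by case: qP => _ + _ _; apply. Qed.

Lemma psdZr c u v : D u -> D v -> q v (c%:C%C *: u) = c * q v u.
Proof.
by move=> *; rewrite psdC ?psdZl ?(psdC (u := v))//; exact: subspaceZ.
Qed.

Lemma psd_ge0 u : D u -> 0 <= q u u.
Proof. by case: qP => _ _ _; apply. Qed.

Lemma psdB u v : D u -> D v ->
  q (u - v) (u - v) = q u u - 2 * q u v + q v v.
Proof.
move=> Du Dv; have Dw : D ((-1)%:C%C *: v) by exact: subspaceZ.
have -> : u - v = u + (-1)%:C%C *: v by rewrite rmorphN rmorph1 scaleN1r.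
rewrite psdDl ?psdDr ?psdZl ?psdZr//; last exact: subspaceD.
by rewrite (psdC Dv Du); ring.
Qed.

Lemma psd_polar t u v : D u -> D v ->
  q (u + t%:C%C *: v) (u + t%:C%C *: v) = q u u + 2 * t * q u v + t ^+ 2 * q v v.
Proof.
move=> Du Dv; have Dw : D (t%:C%C *: v) by exact: subspaceZ.
rewrite psdDl ?psdDr ?psdZl ?psdZr//; last exact: subspaceD.
by rewrite (psdC Dv Du); ring.
Qed.

(** The polynomial q(u + t v, u + t v) in the real variable t is never negative. *)
Lemma psd_CS u v : D u -> D v -> q u v ^+ 2 <= q u u * q v v.
Proof.
move=> Du Dv.
have P t : 0 <= q u u + 2 * t * q u v + t ^+ 2 * q v v.
  rewrite -psd_polar//; apply: psd_ge0.
  by apply: subspaceD => //; exact: subspaceZ.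
have [v0|vn0] := eqVneq (q v v) 0.
  have [->|q0] := eqVneq (q u v) 0; first by rewrite expr0n v0 mulr0.
  (* If q(v, v) = 0 the polynomial is affine in t; at this t it equals -1. *)
  have := P (- (q u u + 1) / (2 * q u v)); rewrite v0 mulr0 addr0.
  have -> : 2 * (- (q u u + 1) / (2 * q u v)) * q u v = - (q u u + 1) by field.
  by rewrite opprD addrA subrr sub0r lerNr oppr0 ler10.
have vp : 0 < q v v by rewrite lt_neqAle eq_sym vn0 psd_ge0.
(* The minimum of the quadratic polynomial. *)
have := P (- q u v / q v v).
have -> : q u u + 2 * (- q u v / q v v) * q u v + (- q u v / q v v) ^+ 2 * q v v
   = (q u u * q v v - q u v ^+ 2) / q v v by field.
by rewrite pmulr_lge0 ?invr_gt0// subr_ge0.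
Qed.

Definition qnorm u := Num.sqrt (q u u).

Lemma sqr_qnorm u : D u -> qnorm u ^+ 2 = q u u.
Proof. by move=> Du; rewrite sqr_sqrtr// psd_ge0. Qed.

Lemma psd_CSn u v : D u -> D v -> `|q u v| <= qnorm u * qnorm v.
Proof.
move=> Du Dv; rewrite -sqrtrM ?psd_ge0// -sqrtr_sqr ler_wsqrtr//.
exact: psd_CS.
Qed.

Lemma qnormD u v : D u -> D v -> qnorm (u + v) <= qnorm u + qnorm v.
Proof.
move=> Du Dv; rewrite -(@ler_pXn2r _ 2)// ?nnegrE ?addr_ge0 ?sqrtr_ge0//.
rewrite sqrrD !sqr_qnorm//; last exact: subspaceD.
rewrite -[v in X in X <= _]scale1r -[1]/(1%:C%C) psd_polar//.
have := ler_norm (q u v); have := psd_CSn Du Dv; lra.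
Qed.

(** The partial geometric sum is kept exact, so that the triangle inequality closes the induction
    with an equality. *)
Lemma qnorm_geometric (x : nat -> V) (C r : R) :
  (forall k, D (x k)) -> 0 <= C -> 0 <= r < 1 ->
  (forall k, qnorm (x k - x k.+1) <= C * r ^+ k) ->
  forall n k, qnorm (x n - x (n + k)%N) <= C / (1 - r) * (r ^+ n - r ^+ (n + k)).
Proof.
move=> Dx C0 /andP[r0 r1] xr n; elim=> [|k IH].
  rewrite addn0 !subrr mulr0 /qnorm.
  have <- : (0 : R)%:C%C *: 0 = 0 :> V by rewrite scaler0.
  by rewrite psdZl ?mul0r ?sqrtr0//; [case: sD|apply: subspaceZ; case: sD].
have -> : x n - x (n + k.+1)%N = (x n - x (n + k)%N) + (x (n + k)%N - x (n + k.+1)%N).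
  by rewrite addrA subrK.
have DB i j : D (x i - x j) by exact: subspaceB.
apply: le_trans (qnormD (DB _ _) (DB _ _)) _.
rewrite addnS; apply: le_trans (lerD IH (xr _)) _.
rewrite exprS le_eqVlt; apply/orP; left; apply/eqP; field; lra.
Qed.

Lemma geometric_cauchy (x : nat -> V) (C r : R) :
  (forall k, D (x k)) -> 0 <= C -> 0 <= r < 1 ->
  (forall k, qnorm (x k - x k.+1) <= C * r ^+ k) ->
  forall e : R, 0 < e -> exists N, forall n m, (N <= n)%N -> (N <= m)%N ->
    qnorm (x n - x m) < e.
Proof.
move=> Dx C0 r01 xr e e0.
have [r0 r1] := andP r01.
have : (fun n => C / (1 - r) * r ^+ n) @ \oo --> (C / (1 - r) * 0 : R).
  by apply: cvgMr; apply: cvg_expr; rewrite ger0_norm.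
rewrite mulr0 => /cvgrPdist_lt /(_ e e0)[N _ NP].
have H n k : (N <= n)%N -> qnorm (x n - x (n + k)%N) < e.
  move=> Nn; apply: le_lt_trans (qnorm_geometric Dx C0 r01 xr n k) _.
  apply: le_lt_trans (NP n Nn); rewrite sub0r normrN ger0_norm.
    by rewrite ler_wpM2l ?divr_ge0 ?subr_ge0 ?(ltW r1)// lerBlDr lerDl exprn_ge0.
  by rewrite mulr_ge0 ?divr_ge0 ?subr_ge0 ?(ltW r1)// exprn_ge0.
exists N => n m Nn Nm.
have [nm|mn] := leP n m; first by rewrite -(subnKC nm) H.
have -> : qnorm (x n - x m) = qnorm (x m - x n).
  rewrite /qnorm; congr Num.sqrt; rewrite !psdB// (psdC (Dx n) (Dx m)); ring.
by rewrite -(subnKC (ltnW mn)) H.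
Qed.

End RealForms.

(** * Hermitian forms on a subspace and their real parts *)

Section HermitianForms.
Set Implicit Arguments. Unset Strict Implicit.
Variables (R : realType) (V : lmodType R[i]).

Definition hermitian_on (D : set V) (p : V -> V -> R[i]) : Prop :=
  (forall (c : R[i]) u v w, D u -> D v -> D w ->
     p (c *: u + v) w = c * p u w + p v w) /\
  (forall u v, D u -> D v -> p u v = conjc (p v u)).

Lemma sub_hermitian (D E : set V) p : E `<=` D -> hermitian_on D p -> hermitian_on E p.
Proof.
move=> ED [pl pC]; split; first by move=> *; apply: pl; exact: ED.
by move=> *; apply: pC; exact: ED.
Qed.

Section Hermitian.
Variables (D : set V) (p : V -> V -> R[i]).
Hypotheses (sD : subspace D) (pP : hermitian_on D p).

Lemma herm0l w : D w -> p 0 w = 0.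
Proof.
case: sD => D0 _ Dw; case: pP => /(_ 1 0 0 w D0 D0 Dw) + _.
by rewrite scaler0 addr0 mul1r => /eqP; rewrite -subr_eq0 opprD addrA subrr sub0r oppr_eq0 => /eqP.
Qed.

Lemma hermZl c u w : D u -> D w -> p (c *: u) w = c * p u w.
Proof.
move=> Du Dw; case: sD => D0 _; case: pP => /(_ c u 0 w Du D0 Dw) + _.
by rewrite !addr0 herm0l// addr0.
Qed.

Lemma hermDl u v w : D u -> D v -> D w -> p (u + v) w = p u w + p v w.
Proof.
by move=> Du Dv Dw; case: pP => /(_ 1 u v w Du Dv Dw) + _; rewrite scale1r mul1r.
Qed.

Lemma hermC u v : D u -> D v -> p u v = conjc (p v u).
Proof. by case: pP => _; apply. Qed.

Lemma hermBl u v w : D u -> D v -> D w -> p (u - v) w = p u w - p v w.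
Proof.
move=> Du Dv Dw; rewrite -scaleN1r hermDl ?hermZl ?mulN1r//.
exact: subspaceZ.
Qed.

Lemma hermDr u v w : D u -> D v -> D w -> p w (u + v) = p w u + p w v.
Proof.
move=> Du Dv Dw; rewrite hermC//; last exact: subspaceD.
by rewrite hermDl// rmorphD/= -!hermC.
Qed.

Lemma hermZr c u w : D u -> D w -> p w (c *: u) = conjc c * p w u.
Proof.
move=> Du Dw; rewrite hermC//; last exact: subspaceZ.
by rewrite hermZl// rmorphM/= -hermC.
Qed.

Lemma hermBr u v w : D u -> D v -> D w -> p w (u - v) = p w u - p w v.
Proof.
move=> Du Dv Dw; rewrite hermC//; last exact: subspaceB.
by rewrite hermBl// rmorphB/= -!hermC.
Qed.

Lemma herm_suml n (c : 'I_n -> R[i]) (f : 'I_n -> V) w :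
  (forall i, D (f i)) -> D w -> p (\sum_i c i *: f i) w = \sum_i c i * p (f i) w.
Proof.
move=> Df Dw; elim: n c f Df => [|n IH] c f Df; first by rewrite !big_ord0 herm0l.
rewrite !big_ord_recr/= hermDl ?IH ?hermZl//; last exact: subspaceZ.
by apply: subspace_sum => // i; exact: subspaceZ.
Qed.

Lemma hermRe_sym u v : D u -> D v -> complex.Re (p u v) = complex.Re (p v u).
Proof. by move=> Du Dv; rewrite hermC//; case: (p v u). Qed.

Lemma herm_diag u : D u -> p u u = (complex.Re (p u u))%:C%C.
Proof.
move=> Du; have := hermC Du Du; case: (p u u) => x y /= [/eqP].
rewrite -subr_eq0 opprK -mulr2n mulrn_eq0/= => /eqP -> //.
Qed.

Lemma Re_realM (c : R) (z : R[i]) : complex.Re (c%:C%C * z) = c * complex.Re z.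
Proof. by case: z => x y /=; rewrite mul0r subr0. Qed.

Lemma ReD (y z : R[i]) : complex.Re (y + z) = complex.Re y + complex.Re z.
Proof. by case: y z => [? ?] [? ?]. Qed.

Lemma ReB (y z : R[i]) : complex.Re (y - z) = complex.Re y - complex.Re z.
Proof. by case: y z => [? ?] [? ?]. Qed.

Lemma psd_Re : (forall u, D u -> 0 <= complex.Re (p u u)) ->
  psd_on D (fun u v => complex.Re (p u v)).
Proof.
move=> p0; split=> //.
- by move=> *; rewrite hermDl ?ReD.
- by move=> *; rewrite hermZl ?Re_realM.
- exact: hermRe_sym.
Qed.

End Hermitian.

(** Serves both for the form norm ([k] = 1 + eta) and for the form of H - m ([k] = - m). *)
Lemma psd_shift D (p p' : V -> V -> R[i]) (k : R) :
  subspace D -> hermitian_on D p -> hermitian_on D p' ->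
  (forall u, D u -> 0 <= complex.Re (p u u) + k * complex.Re (p' u u)) ->
  psd_on D (fun u v => complex.Re (p u v) + k * complex.Re (p' u v)).
Proof.
move=> sD hp hp' p0; split=> //.
- by move=> *; rewrite !(hermDl (D := D)) ?ReD//; ring.
- by move=> *; rewrite !(hermZl (D := D)) ?Re_realM//; ring.
- by move=> u v Du Dv; rewrite (hermRe_sym (D := D))// (hermRe_sym (D := D) hp').
Qed.

End HermitianForms.

(** * Orthonormal families, Pythagoras and Bessel *)

Section Orthonormal.
Set Implicit Arguments. Unset Strict Implicit.
Variables (R : realType) (V : lmodType R[i]) (ip : V -> V -> R[i]).
Hypothesis ipP : is_hilbert ip.

Lemma ip_hermitian (D : set V) : hermitian_on D ip.
Proof. by case: ipP => il iC _ _ _; split=> *; [exact: il|exact: iC]. Qed.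

Lemma subspaceT : subspace [set: V]. Proof. by []. Qed.

Let hT := @ip_hermitian setT.

Definition re_ip u v : R := complex.Re (ip u v).
Local Notation rip := re_ip.

Lemma rip_psd (D : set V) : subspace D -> psd_on D rip.
Proof.
by move=> sD; apply: psd_Re => //; [exact: ip_hermitian|case: ipP].
Qed.

Lemma ipDl u v w : ip (u + v) w = ip u w + ip v w.
Proof. exact: (hermDl hT). Qed.
Lemma ipZl c u w : ip (c *: u) w = c * ip u w.
Proof. exact: (hermZl subspaceT hT). Qed.
Lemma ipZr c u w : ip w (c *: u) = conjc c * ip w u.
Proof. exact: (hermZr subspaceT hT). Qed.
Lemma ipBl u v w : ip (u - v) w = ip u w - ip v w.
Proof. exact: (hermBl subspaceT hT). Qed.
Lemma ipC u v : ip u v = conjc (ip v u).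
Proof. exact: (hermC hT). Qed.
Lemma ip0l v : ip 0 v = 0.
Proof. exact: (herm0l subspaceT hT). Qed.
Lemma ip_suml n (c : 'I_n -> R[i]) (f : 'I_n -> V) w :
  ip (\sum_i c i *: f i) w = \sum_i c i * ip (f i) w.
Proof. exact: (herm_suml subspaceT hT). Qed.
Lemma ip_diag u : ip u u = (rip u u)%:C%C.
Proof. exact: (herm_diag hT). Qed.
Lemma rip_ge0 u : 0 <= rip u u.
Proof. by case: ipP => _ _ + _ _; apply. Qed.
Lemma rip_eq0 u : rip u u = 0 -> u = 0.
Proof. by case: ipP => _ _ _ i0 _ u0; apply: i0; rewrite ip_diag u0. Qed.
Lemma rip_gt0 u : u <> 0 -> 0 < rip u u.
Proof.
move=> u0; rewrite lt_neqAle rip_ge0 andbT eq_sym.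
by apply/eqP => /rip_eq0.
Qed.
Lemma hnormE u : hnorm ip u = qnorm rip u. Proof. by []. Qed.
Lemma sqr_hnorm u : hnorm ip u ^+ 2 = rip u u.
Proof. by rewrite sqr_sqrtr// rip_ge0. Qed.

Definition normsq (z : R[i]) : R := complex.Re z ^+ 2 + complex.Im z ^+ 2.

Lemma normsq_ge0 z : 0 <= normsq z.
Proof. by rewrite addr_ge0 ?sqr_ge0. Qed.

Lemma normsqE z : z * conjc z = (normsq z)%:C%C.
Proof.
by case: z => x y; apply/eqP; rewrite eq_complex /normsq/=; apply/andP; split; apply/eqP; ring.
Qed.

Lemma normsq_conj z : normsq (conjc z) = normsq z.
Proof. by case: z => x y; rewrite /normsq/= sqrrN. Qed.

(** Families are indexed by [nat] and only the first [n] entries count, so a family is lengthened by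
    [extend] without casts between ordinals. *)
Definition orthonormal n (e : nat -> V) : Prop :=
  forall i j, (i < n)%N -> (j < n)%N -> ip (e i) (e j) = (i == j)%:R.

Definition proj n (e : nat -> V) (u : V) : V := \sum_(i < n) ip u (e i) *: e i.

Lemma ip_orthonormal_sum n e (c : nat -> R[i]) j : orthonormal n e -> (j < n)%N ->
  ip (\sum_(i < n) c i *: e i) (e j) = c j.
Proof.
move=> on jn; rewrite ip_suml (bigD1 (Ordinal jn))//= big1 ?addr0.
  by rewrite on// eqxx mulr1.
move=> i /negbTE ij; rewrite on//.
by rewrite -[(_ == _)]/(i == Ordinal jn) ij mulr0.
Qed.

Lemma ip_residual n e u j : orthonormal n e -> (j < n)%N ->
  ip (u - proj n e u) (e j) = 0.
Proof.
by move=> on jn; rewrite ipBl (ip_orthonormal_sum (fun i => ip u (e i)) on jn) subrr.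
Qed.

Lemma residual_subspace D n e u : subspace D -> (forall i, (i < n)%N -> D (e i)) ->
  D u -> D (u - proj n e u).
Proof.
move=> sD De Du; apply: subspaceB => //; apply: subspace_sum => // i.
by apply: subspaceZ => //; exact: De.
Qed.

(* The case [p = ip], [mu = 1] is Pythagoras' theorem. *)
Lemma herm_decomposition D (p : V -> V -> R[i]) n e (mu : nat -> R) u :
  subspace D -> hermitian_on D p -> orthonormal n e ->
  (forall i, (i < n)%N -> D (e i)) ->
  (forall i v, (i < n)%N -> D v -> p (e i) v = (mu i)%:C%C * ip (e i) v) ->
  D u ->
  complex.Re (p u u) = \sum_(i < n) mu i * normsq (ip u (e i)) +
    complex.Re (p (u - proj n e u) (u - proj n e u)).
Proof.
move=> sD hp on De pe Du; set w := u - proj n e u; set s := proj n e u.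
have us : u = s + w by rewrite addrC subrK.
have Dw : D w by exact: residual_subspace.
have Ds : D s by rewrite -[s](subKr u); exact: subspaceB.
have psx x : D x -> p s x = \sum_(i < n) ip u (e i) * ((mu i)%:C%C * ip (e i) x).
  move=> Dx; rewrite (herm_suml sD hp)//; last by move=> i; exact: De.
  by apply: eq_bigr => i _; rewrite pe.
have psw : p s w = 0.
  rewrite psx// big1// => i _.
  by rewrite (ipC (e i)) ip_residual// rmorph0 !mulr0.
have pws : p w s = 0 by rewrite (hermC hp)// psw rmorph0.
have -> : p u u = p s s + p w w.
  rewrite us (hermDl hp Ds Dw (subspaceD sD Ds Dw)).
  by rewrite (hermDr sD hp Ds Dw Ds) (hermDr sD hp Ds Dw Dw) psw pws addr0 add0r.
rewrite ReD; congr (_ + _).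
rewrite psx//.
have -> : \sum_(i < n) ip u (e i) * ((mu i)%:C%C * ip (e i) s)
  = (\sum_(i < n) mu i * normsq (ip u (e i)))%:C%C.
  rewrite rmorph_sum/=; apply: eq_bigr => i _.
  rewrite (ipC (e i)) /s (ip_orthonormal_sum (fun i => ip u (e i)) on)//.
  by rewrite mulrCA normsqE rmorphM.
by [].
Qed.

Lemma pythagoras n e u : orthonormal n e ->
  rip u u = \sum_(i < n) normsq (ip u (e i)) +
    rip (u - proj n e u) (u - proj n e u).
Proof.
move=> on; rewrite {1}/re_ip (@herm_decomposition setT ip n e (fun=> 1) u)//.
  by congr (_ + _); apply: eq_bigr => i _; rewrite mul1r.
by move=> i v _ _; rewrite mul1r.
Qed.

Lemma bessel n e u : orthonormal n e -> \sum_(i < n) normsq (ip u (e i)) <= rip u u.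
Proof. by move=> on; rewrite (pythagoras u on) lerDl rip_ge0. Qed.

Lemma normalize u : u <> 0 -> exists2 c : R, c != 0 & ip (c%:C%C *: u) (c%:C%C *: u) = 1.
Proof.
move=> /rip_gt0 u0; exists (Num.sqrt (rip u u))^-1.
  by rewrite invr_eq0 sqrtr_eq0 -ltNge.
rewrite ipZl ipZr conjc_real ip_diag -!rmorphM/= mulrA -invfM -expr2 sqr_sqrtr ?ltW//.
by rewrite mulVf ?gt_eqF.
Qed.

Definition extend (T : Type) n (e : nat -> T) (x : T) k : T := if k == n then x else e k.

Lemma extend_lt T n (e : nat -> T) x k : (k < n)%N -> extend n e x k = e k.
Proof. by move=> kn; rewrite /extend ltn_eqF. Qed.

Lemma extend_eq T n (e : nat -> T) x : extend n e x n = x.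
Proof. by rewrite /extend eqxx. Qed.

Lemma orthonormal_extend n e x : orthonormal n e ->
  (forall i, (i < n)%N -> ip x (e i) = 0) -> ip x x = 1 ->
  orthonormal n.+1 (extend n e x).
Proof.
move=> on xe xx i j.
rewrite ltnS leq_eqVlt => /orP[/eqP->|ilt].
  rewrite ltnS leq_eqVlt => /orP[/eqP->|jlt].
    by rewrite !extend_eq eqxx xx.
  rewrite extend_eq (extend_lt _ _ jlt).
  rewrite xe//.
  by rewrite gtn_eqF.
rewrite ltnS leq_eqVlt => /orP[/eqP->|jlt].
  rewrite extend_eq (extend_lt _ _ ilt).
  by rewrite ipC xe// rmorph0 ltn_eqF.
by rewrite (extend_lt _ _ ilt) (extend_lt _ _ jlt) on.
Qed.

End Orthonormal.

(** * Infimum of a quotient *)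

Section BestConstant.
Set Implicit Arguments. Unset Strict Implicit.
Variable R : realType.

(** [m] is the infimum of f / g, taken as the supremum of the constants d with d g <= f, so that
    points where g vanishes stay allowed. If no point came within [tau], then m + tau would be such
    a constant too. *)
Lemma best_constant (T : Type) (P : T -> Prop) (f g : T -> R) (d0 : R) t0 :
  (forall t, P t -> 0 <= g t) -> (forall t, P t -> d0 * g t <= f t) ->
  P t0 -> 0 < g t0 ->
  exists2 m, d0 <= m & (forall t, P t -> m * g t <= f t) /\
    forall tau, 0 < tau -> exists2 t, P t & f t < (m + tau) * g t.
Proof.
move=> g0 d0P Pt0 gt0; pose L := [set d : R | forall t, P t -> d * g t <= f t].
have supL : has_sup L.
  split; first by exists d0.
  by exists (f t0 / g t0) => d /(_ _ Pt0); rewrite ler_pdivlMr.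
exists (sup L); first exact: (sup_upper_bound supL).
split=> [t Pt|tau tau0].
  have := g0 t Pt; rewrite le_eqVlt => /predU1P[gt|gtp].
    by have := d0P t Pt; rewrite -gt !mulr0.
  rewrite -ler_pdivlMr//; apply: ge_sup; first by exists d0.
  by move=> d /(_ _ Pt); rewrite ler_pdivlMr.
apply: contrapT => nP.
have : L (sup L + tau).
  move=> t Pt; rewrite leNgt; apply/negP => tl; apply: nP; by exists t.
by move/(sup_upper_bound supL); rewrite gerDl leNgt tau0.
Qed.

End BestConstant.

(** * Symmetric operators and gaps in the spectrum *)

Section Operator.
Set Implicit Arguments. Unset Strict Implicit.
Variables (R : realType) (V : lmodType R[i]) (ip : V -> V -> R[i]).
Hypothesis ipP : is_hilbert ip.
Variables (D : set V) (h : V -> V -> R[i]).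
Hypotheses (sD : subspace D) (hP : hermitian_on D h).
Local Notation rip := (re_ip ip).
Local Notation Hop := (assoc_op ip D h).

Lemma op_linear (c : R[i]) u v f g : Hop u f -> Hop v g -> Hop (c *: u + v) (c *: f + g).
Proof.
move=> [Du uf] [Dv vg]; split; first by case: sD => _; apply.
move=> w Dw; rewrite (hermDl hP)//; last exact: subspaceZ.
by rewrite (hermZl sD hP)// uf// vg// (ipDl ipP) (ipZl ipP).
Qed.

Lemma op_symmetric u v f g : Hop u f -> Hop v g -> ip f v = ip u g.
Proof. by move=> [Du uf] [Dv vg]; rewrite -uf// (hermC hP)// vg// -(ipC ipP). Qed.

Lemma rip_op u v f : Hop u f -> D v -> rip f v = complex.Re (h u v).
Proof. by move=> [Du uf] Dv; rewrite uf. Qed.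

Lemma resolvent_bound (z : R[i]) : in_resolvent ip Hop z -> exists2 k : R, 0 < k &
  forall u g, Hop u g -> rip u u <= k * rip (z *: u - g) (z *: u - g).
Proof.
(* Nothing is known about the sign of [c]; c^2 + 1 is positive and bounds the squares. *)
move=> [_ _ [c cP]]; exists (c ^+ 2 + 1); first by rewrite ltr_wpDl ?sqr_ge0.
move=> u g ug; have := cP u g ug; rewrite -!(sqr_hnorm ipP) => uc.
have n0 w : 0 <= hnorm ip w by exact: sqrtr_ge0.
apply: (@le_trans _ _ (c ^+ 2 * hnorm ip (z *: u - g) ^+ 2)).
  by rewrite -exprMn ler_pXn2r// nnegrE//; apply: le_trans uc.
by rewrite ler_wpM2r ?sqr_ge0// lerDl.
Qed.

Let sT := @subspaceT R V.
Let rT := rip_psd ipP sT.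

(* Let d be the infimum of |(z - H) w| / |w|.  On almost extremal vectors
   (z - H)^2 - d^2 is nearly zero, so z - d and z + d are not both in the
   resolvent set. *)
Lemma gap_bound (z r : R) : 0 < r ->
  (forall x : R, z - r < x < z + r -> in_resolvent ip Hop (x%:C)%C) ->
  forall u g, Hop u g ->
    r ^+ 2 * rip u u <= rip (z%:C%C *: u - g) (z%:C%C *: u - g).
Proof.
move=> r0 res u0 g0 ug0; rewrite leNgt; apply/negP => lt0.
have zres : in_resolvent ip Hop (z%:C)%C by apply: res; lra.
have [k0 k00 k0P] := resolvent_bound zres.
pose f (t : V * V) := rip (z%:C%C *: t.1 - t.2) (z%:C%C *: t.1 - t.2).
have u00 : 0 < rip u0 u0.
  rewrite -(pmulr_rgt0 _ (exprn_gt0 2 r0)).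
  by apply: le_lt_trans lt0; exact: rip_ge0.
(* [m] = d^2 is the infimum of |(z - H) u|^2 / |u|^2 over the graph; the resolvent bound at [z]
   makes it positive, and [lt0] puts it below r^2. *)
have [||m mk [mP ml]] := @best_constant R (V * V) (fun t => Hop t.1 t.2) f
    (fun t => rip t.1 t.1) k0^-1 (u0, g0) _ _ ug0 u00.
- by move=> *; exact: rip_ge0.
- by move=> [u g]/= ug; rewrite ler_pdivrMl//; exact: k0P.
have m0 : 0 < m by apply: lt_le_trans mk; rewrite invr_gt0.
have mr : m < r ^+ 2.
  have := mP (u0, g0) ug0 => /= ml0.
  by have := le_lt_trans ml0 lt0; rewrite ltr_pM2r.
pose d := Num.sqrt m.
have d0 : 0 < d by rewrite sqrtr_gt0.
have dd : d * d = m by rewrite -expr2 sqr_sqrtr// ltW.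
have dr : d < r by rewrite -(@ltr_pXn2r _ 2)// ?nnegrE ?ltW// expr2 dd.
have [k1 k10 k1P] : exists2 k : R, 0 < k & forall u g, Hop u g ->
    rip u u <= k * rip ((z - d)%:C%C *: u - g) ((z - d)%:C%C *: u - g).
  by apply: resolvent_bound; apply: res; lra.
have [k2 k20 k2P] : exists2 k : R, 0 < k & forall u g, Hop u g ->
    rip u u <= k * rip ((z + d)%:C%C *: u - g) ((z + d)%:C%C *: u - g).
  by apply: resolvent_bound; apply: res; lra.
pose K := (m + 1) * (k1 * k2).
have K0 : 0 < K by rewrite !mulr_gt0// ltr_wpDl// ltW.
(* Chosen so that tau <= 1 and K tau < 1, which the last estimate needs. *)
pose tau := (K + 1)^-1.
have tau0 : 0 < tau by rewrite invr_gt0 addr_gt0.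
have tau1 : tau <= 1 by rewrite invf_le1 ?lerDr ?ltW// addr_gt0.
have [[w g]/= wg fw] := ml _ tau0.
rewrite /f/= in fw; set x := z%:C%C *: w - g in fw.
have w0 : 0 < rip w w.
  have : 0 < (m + tau) * rip w w by apply: le_lt_trans fw; exact: rip_ge0.
  by rewrite pmulr_rgt0// addr_gt0.
(* With x = (z - H) w and (z - H) y = w, symmetry gives <x, y> = <w, (z - H) y> = |w|^2. *)
have [/(_ w)[y [gy [ygy ywE]]] _ _] := zres.
have xy : rip x y = rip w w.
  have wE : ip w w = ip w (z%:C%C *: y - gy) by rewrite ywE.
  rewrite /re_ip wE /x (ipBl ipP) (ipZl ipP) (op_symmetric wg ygy).
  by rewrite (hermBr sT (ip_hermitian ipP setT))// (ipZr ipP) conjc_real.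
have my : m * rip y y <= rip w w by have := mP (y, gy) ygy; rewrite /f/= ywE.
(* The vector x - m y is ((z - H)^2 - d^2) y; its square expands to at most (m + tau) - 2 m + m =
   tau times |w|^2. *)
have xm : rip (x - m%:C%C *: y) (x - m%:C%C *: y) <= tau * rip w w.
  rewrite (psdB sT rT)// (psdZr sT rT)// (psdZl rT)// (psdZr sT rT)//.
  rewrite xy; have : m * (m * rip y y) <= m * rip w w by rewrite ler_pM2l.
  lra.
(* Factorisation: z - d - H maps d y + w to x - m y, and z + d - H maps y to d y + w. Two resolvent
   bounds therefore make y small. *)
have vv : rip (d%:C%C *: y + w) (d%:C%C *: y + w) <= k1 * (tau * rip w w).
  have := k1P _ _ (op_linear d%:C%C ygy wg).
  have -> : (z - d)%:C%C *: (d%:C%C *: y + w) - (d%:C%C *: gy + g) = x - m%:C%C *: y.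
    have gyE : gy = z%:C%C *: y - w by rewrite -ywE subKr.
    rewrite /x gyE -dd rmorphB rmorphM/= scalerDr !scalerBl scalerBr !scalerA.
    rewrite (mulrC d%:C%C z%:C%C) opprD opprB.
    by rewrite (AC ((2*2)*(2*1)) ((1*6)*(5*4)*((3*7)*2)))/= !subrr !add0r.
  by move/le_trans; apply; rewrite ler_pM2l.
have yy : rip y y <= k2 * (k1 * (tau * rip w w)).
  apply: le_trans (k2P _ _ ygy) _; rewrite ler_pM2l//.
  by rewrite rmorphD/= scalerDl addrAC ywE addrC.
(* Cauchy-Schwarz gives |w|^4 <= |x|^2 |y|^2 <= K tau |w|^4, which is absurd since K tau < 1. *)
have := psd_CS sT rT (u := x) (v := y) I I; rewrite xy.
apply/negP; rewrite -ltNge.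
apply: (@le_lt_trans _ _ ((m + tau) * rip w w * (k2 * (k1 * (tau * rip w w))))).
  by apply: ler_pM => //; rewrite ?rip_ge0// ltW.
rewrite (_ : _ * _ * _ = ((m + tau) * (k1 * k2) * tau) * rip w w ^+ 2); last by ring.
rewrite gtr_pMl ?exprn_gt0//.
apply: (@le_lt_trans _ _ (K * tau)).
  by rewrite ler_pM2r// ler_pM2r ?mulr_gt0// lerD2l.
by rewrite ltr_pdivrMr ?mul1r ?ltrDl// addr_gt0.
Qed.

End Operator.

(** * An eigenvector at the bottom of the form on the complement of finitely many eigenvectors *)

Section Bottom.
Set Implicit Arguments. Unset Strict Implicit.
Variables (R : realType) (V : lmodType R[i]) (ip : V -> V -> R[i]).
Hypothesis ipP : is_hilbert ip.
Variables (D : set V) (h : V -> V -> R[i]) (eta : R).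
Hypotheses (sD : subspace D) (hP : hermitian_on D h).
Hypothesis hb : forall u, D u -> 0 <= complex.Re (h u u) + eta * re_ip ip u u.
Hypothesis h_closed : closed_form ip D h eta.
Local Notation rip := (re_ip ip).
Local Notation Hop := (assoc_op ip D h).

Let sT := @subspaceT R V.
Let rT := rip_psd ipP sT.

(** The real part of the scalar product that induces [fnorm]. *)
Definition form_re u v : R := complex.Re (h u v) + (1 + eta) * rip u v.

Lemma form_re_psd : psd_on D form_re.
Proof.
apply: psd_shift => //; first exact: ip_hermitian.
move=> u Du; rewrite mulrDl mul1r addrCA addrC.
by apply: addr_ge0; [exact: hb|exact: (rip_ge0 ipP)].
Qed.

Lemma fnormE u : fnorm ip h eta u = qnorm form_re u.
Proof. by rewrite /fnorm (sqr_hnorm ipP). Qed.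

Lemma hnorm_le_fnorm u : D u -> hnorm ip u <= qnorm form_re u.
Proof.
move=> Du; rewrite hnormE /qnorm ler_wsqrtr// /form_re mulrDl mul1r addrCA lerDl.
exact: hb.
Qed.

(* Complex identities follow from their real parts, by replacing v with i v. *)
Lemma Re_separates (E : set V) (F G : V -> R[i]) :
  (forall v, E v -> E ('i%C *: v)) ->
  (forall v, E v -> F ('i%C *: v) = conjc 'i%C * F v) ->
  (forall v, E v -> G ('i%C *: v) = conjc 'i%C * G v) ->
  (forall v, E v -> complex.Re (F v) = complex.Re (G v)) ->
  forall v, E v -> F v = G v.
Proof.
move=> Ei Fi Gi FG v Ev; have := FG _ (Ei v Ev); rewrite Fi// Gi//.
have := FG v Ev; case: (F v) (G v) => [a b] [c d] /= -> bd.
by apply/eqP; rewrite eq_complex /= eqxx/=; apply/eqP; lra.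
Qed.

Variables (n : nat) (e : nat -> V) (mu : nat -> R).
Hypothesis e_eigen : forall i, (i < n)%N -> Hop (e i) ((mu i)%:C%C *: e i).

Definition eigen_compl : set V := [set w | D w /\ forall i, (i < n)%N -> ip w (e i) = 0].

Lemma eigen_compl_sub : eigen_compl `<=` D. Proof. by move=> w []. Qed.

Lemma subspace_eigen_compl : subspace eigen_compl.
Proof.
split; first by split; [case: sD|move=> i _; exact: (ip0l ipP)].
move=> c u v [Du u0] [Dv v0]; split; first by case: sD => _; apply.
by move=> i ilt; rewrite (ipDl ipP) (ipZl ipP) u0// v0// mulr0 addr0.
Qed.

Let sW := subspace_eigen_compl.

(** By symmetry <(z - H) u, e_i> = (z - mu_i) <u, e_i>, and the factor does not vanish. Hence the
    resolvent at [z] preserves the complement. *)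
Lemma eigen_compl_resolvent (z : R) u g : Hop u g ->
  (forall i, (i < n)%N -> mu i != z) ->
  (forall i, (i < n)%N -> ip (z%:C%C *: u - g) (e i) = 0) -> eigen_compl u.
Proof.
move=> ug muz f0; split; first by case: ug.
move=> i ilt; have := f0 i ilt; rewrite (ipBl ipP) (ipZl ipP).
rewrite (op_symmetric ipP hP ug (e_eigen ilt)) (ipZr ipP) conjc_real -mulrBl -rmorphB/=.
move/eqP; rewrite mulf_eq0 => /orP[|/eqP//].
by rewrite -(rmorph0 (real_complex R)) (inj_eq (@complexI R)) subr_eq0 eq_sym (negbTE (muz i ilt)).
Qed.

Variables (m s c : R).
Hypotheses (s0 : 0 < s) (c0 : 0 < c).
(** The form of G = H - m. The hypotheses [b_ge0] and [b_inf] make [m] the infimum of the Rayleigh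
    quotient on the complement, and [b_gap] is the inequality |G w|^2 >= c <G w, w>. *)
Let b u v : R := complex.Re (h u v) + (- m) * rip u v.
Hypothesis b_ge0 : forall w, eigen_compl w -> 0 <= b w w.
Hypothesis b_inf : forall tau, 0 < tau -> exists2 w, eigen_compl w & b w w < tau * rip w w.
Hypothesis m_res : in_resolvent ip Hop (m - s)%:C%C.
Hypothesis mu_neq : forall i, (i < n)%N -> mu i != m - s.
Hypothesis b_gap : forall w g, eigen_compl w -> Hop w g ->
  c * b w w <= rip (g - m%:C%C *: w) (g - m%:C%C *: w).

Let bW : psd_on eigen_compl b.
Proof.
apply: psd_shift => //; last exact: ip_hermitian.
exact: sub_hermitian eigen_compl_sub _.
Qed.

(* x' = s (H - m + s)^-1 x *)
Lemma bottom_step x : eigen_compl x -> exists x', [/\ eigen_compl x',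
  Hop x' (m%:C%C *: x' + s%:C%C *: (x - x')),
  (1 + 2 * c / s) * b x' x' <= b x x,
  2 * s * rip (x - x') (x - x') <= b x x &
  b (x - x') (x - x') <= b x x].
Proof.
move=> Wx; have [/(_ (- s%:C%C *: x))[x' [g [xg gE]]] _ _] := m_res.
have gE' : g = m%:C%C *: x' + s%:C%C *: (x - x').
  rewrite -[g](subKr ((m - s)%:C%C *: x')) gE rmorphB/= scaleNr opprK scalerBl scalerBr.
  by rewrite addrAC addrA.
have Wx' : eigen_compl x'.
  apply: eigen_compl_resolvent xg mu_neq _ => i ilt.
  by case: Wx => _ /(_ i ilt) xi; rewrite gE (ipZl ipP) xi mulr0.
exists x'; rewrite -gE'; set y := x - x'.
have Wy : eigen_compl y by exact: subspaceB.
have gmE : g - m%:C%C *: x' = s%:C%C *: y by rewrite gE' addrC addKr.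
have Dx' := eigen_compl_sub Wx'; have Dy := eigen_compl_sub Wy.
have by' v : D v -> b x' v = s * rip y v.
  move=> Dv; rewrite /b -(rip_op xg Dv) -(psdZl rT s (u := y) (v := v) I I) -gmE.
  by rewrite /re_ip (ipBl ipP) (ipZl ipP) ReB Re_realM mulNr.
(* Since G x' = s y, the cross term b(x', y) is s |y|^2. [b_gap] at x' then bounds it below by (c /
   s) b(x', x'), whence the contraction factor 1 + 2 c / s. *)
have bx : b x x = b x' x' + 2 * (s * rip y y) + b y y.
  rewrite (_ : x = x' + 1%:C%C *: y); last by rewrite rmorph1 scale1r addrC subrK.
  by rewrite (psd_polar sW bW 1 Wx' Wy) (by' _ Dy) mulr1 expr1n mul1r.
have g1 : c * b x' x' <= s ^+ 2 * rip y y.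
  have := b_gap Wx' xg; rewrite gmE (psdZl rT)// (psdZr sT rT)//.
  by rewrite mulrA -expr2.
have b1 := b_ge0 Wx'; have b2 := b_ge0 Wy; have r1 := rip_ge0 ipP y.
have sr : 0 <= s * rip y y by rewrite mulr_ge0// ltW.
split => //.
- have : (2 * c / s) * b x' x' <= 2 * (s * rip y y).
    have -> : 2 * c / s * b x' x' = 2 / s * (c * b x' x') by ring.
    have -> : 2 * (s * rip y y) = 2 / s * (s ^+ 2 * rip y y) by field; rewrite gt_eqF.
    by rewrite ler_pM2l ?divr_gt0.
  lra.
- lra.
- lra.
Qed.

(** The increments of the iterates shrink geometrically both in [b] and in the norm, hence in the
    form norm, and closedness yields a limit y. As G x_{j+1} = s (x_j - x_{j+1}) tends to 0, y
    solves G y = 0 weakly. *)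
Lemma bottom_eigenvector : exists2 x, eigen_compl x & x <> 0 /\ Hop x (m%:C%C *: x).
Proof.
pose k := 1 + 2 * c / s.
have k1 : 1 < k by rewrite ltrDl divr_gt0// mulr_gt0.
have k0 : 0 < k by apply: lt_trans k1.
pose r := Num.sqrt k^-1.
have rr : r ^+ 2 = k^-1 by rewrite sqr_sqrtr// invr_ge0 ltW.
have r01 : 0 <= r < 1.
  rewrite sqrtr_ge0/= -(@ltr_pXn2r _ 2)// ?nnegrE ?sqrtr_ge0//.
  by rewrite rr expr1n invf_lt1.
have [r0 r1] := andP r01.
(* With this [tau] the whole path from x0, of length at most sqrt(b(x0, x0) / (2 s)) / (1 - r), is
   shorter than |x0|, so it cannot end at 0. *)
have tau0 : 0 < 2 * s * (1 - r) ^+ 2.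
  by rewrite !mulr_gt0// subr_gt0.
have [x0 Wx0 bx0] := b_inf tau0.
(* Outside the complement [F] takes an arbitrary value; the iterates never leave it. *)
have /choice[F FP] : forall x, exists x', eigen_compl x -> [/\ eigen_compl x',
    Hop x' (m%:C%C *: x' + s%:C%C *: (x - x')),
    k * b x' x' <= b x x,
    2 * s * rip (x - x') (x - x') <= b x x &
    b (x - x') (x - x') <= b x x].
  move=> x; have [Wx|nW] := pselect (eigen_compl x); last by exists 0.
  by have [x' x'P] := bottom_step Wx; exists x'.
pose x j := iter j F x0.
have Wx j : eigen_compl (x j).
  by elim: j => [//|j IH]; case: (FP _ IH).
have Dx j : D (x j) by case: (Wx j).
pose B := b x0 x0.
have B0 : 0 <= B by exact: b_ge0.
have bx j : b (x j) (x j) <= B * (r ^+ j) ^+ 2.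
  elim: j => [|j IH]; first by rewrite expr0 expr1n mulr1.
  have [_ _ + _ _] := FP _ (Wx j); rewrite -ler_pdivlMl// => /le_trans; apply.
  by rewrite (exprS r) exprMn rr mulrCA ler_pM2l ?invr_gt0.
have rx j : rip (x j - x j.+1) (x j - x j.+1) <= B / (2 * s) * (r ^+ j) ^+ 2.
  have [_ _ _ + _] := FP _ (Wx j); rewrite -ler_pdivlMl ?mulr_gt0// => /le_trans; apply.
  by rewrite mulrC mulrAC ler_pM2r ?invr_gt0 ?mulr_gt0.
pose M := 1 + `|m + (1 + eta)|.
have M0 : 0 < M by rewrite ltr_wpDr.
have formE u v : form_re u v = b u v + (m + (1 + eta)) * rip u v.
  by rewrite /form_re /b; ring.
have qD := form_re_psd.
(* The coefficient m + (1 + eta) of the norm part may have either sign, hence its absolute value. *)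
have fx j : form_re (x j - x j.+1) (x j - x j.+1)
    <= (B + `|m + (1 + eta)| * (B / (2 * s))) * (r ^+ j) ^+ 2.
  rewrite formE [leRHS]mulrDl; apply: lerD.
    by have [_ _ _ _ +] := FP _ (Wx j) => /le_trans; apply.
  apply: (@le_trans _ _ (`|m + (1 + eta)| * rip (x j - x j.+1) (x j - x j.+1))).
    by rewrite ler_wpM2r ?(rip_ge0 ipP)// ler_norm.
  by rewrite -mulrA ler_wpM2l.
have geo (q : V -> V -> R) C : 0 <= C ->
    (forall j, q (x j - x j.+1) (x j - x j.+1) <= C * (r ^+ j) ^+ 2) ->
    forall j, qnorm q (x j - x j.+1) <= Num.sqrt C * r ^+ j.
  move=> C0 qx j; rewrite -[r ^+ j]ger0_norm ?exprn_ge0// -sqrtr_sqr -sqrtrM//.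
  by rewrite ler_wsqrtr.
have Bs0 : 0 <= B / (2 * s) by rewrite divr_ge0// mulr_ge0// ltW.
have C0 : 0 <= B + `|m + (1 + eta)| * (B / (2 * s)) by rewrite addr_ge0// mulr_ge0.
have fC := geometric_cauchy sD qD Dx (sqrtr_ge0 _) r01 (geo _ _ C0 fx).
have [||y Dy yP] := h_closed (s := x) => //.
  by move=> eps eps0; have [N NP] := fC _ eps0; exists N => *; rewrite fnormE; exact: NP.
have {}yP eps : 0 < eps -> exists2 j, qnorm form_re (x j - y) < eps &
    qnorm form_re (x j - x j.+1) < eps /\ qnorm form_re (x j.+1 - y) < eps.
  move=> eps0; have [N1 N1P] := fC _ eps0; have [N2 N2P] := yP _ eps0.
  have N12 : (N2 <= maxn N1 N2)%N by exact: leq_maxr.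
  exists (maxn N1 N2); first by rewrite -fnormE; exact: N2P.
  by split; [apply: N1P; rewrite ?leqW// leq_maxl|rewrite -fnormE; apply: N2P; rewrite leqW].
(* Testing eps = |t| / (K + 1), where the 1 keeps the denominator positive, forces t = 0. *)
have small (t K : R) : 0 <= K -> (forall eps, 0 < eps -> `|t| <= eps * K) -> t = 0.
  move=> K0 tK; apply/eqP; rewrite -normr_le0 leNgt; apply/negP => t0.
  have K1 : 0 < K + 1 by rewrite ltr_wpDl.
  have := tK (`|t| / (K + 1)); rewrite divr_gt0// => /(_ isT).
  rewrite mulrAC ler_pdivlMr// mulrDr mulr1 gerDl leNgt t0//.
have n0 u : 0 <= qnorm rip u by exact: sqrtr_ge0.
have yx_le u v : D u -> `|rip u v| <= qnorm form_re u * qnorm rip v.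
  move=> Du; apply: le_trans (psd_CSn sT rT I I) _.
  by rewrite ler_wpM2r// -hnormE; exact: hnorm_le_fnorm.
have DB u v : D u -> D v -> D (u - v) by move=> ? ?; exact: subspaceB.
have Wy : eigen_compl y.
  split=> // i ilt.
  (* The vectors orthogonal to every iterate are stable under multiplication by i, so it is enough
     that the real part of <y, v> vanishes on them; each e_i is one of them. *)
  pose E : set V := [set v | forall j, ip (x j) v = 0].
  apply: (@Re_separates E (ip y) (fun=> 0)) => //.
  - by move=> v Ev j; rewrite (ipZr ipP) Ev mulr0.
  - by move=> v _; rewrite (ipZr ipP).
  - by move=> v _; rewrite mulr0.
  - move=> v Ev; apply: (small (rip y v) (qnorm rip v)) => // eps eps0.
    have [j xyj _] := yP _ eps0.
    have -> : `|rip y v| = `|rip (x j - y) v|.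
      by rewrite /re_ip (ipBl ipP) ReB Ev sub0r normrN.
    by apply: le_trans (yx_le _ _ (DB _ _ (Dx j) Dy)) _; rewrite ler_wpM2r// ltW.
  - by move=> j; case: (Wx j) => _; apply.
exists y => //; split.
  (* [L] bounds the length of the path. If y = 0, some iterate has norm below |x0| - L, although it
     lies within [L] of x0. *)
  move=> y0; pose L := Num.sqrt (B / (2 * s)) / (1 - r).
  have gap0 : 0 < qnorm rip x0 - L.
    rewrite subr_gt0 ltr_pdivrMr ?subr_gt0//.
    rewrite -(@ltr_pXn2r _ 2)// ?nnegrE ?sqrtr_ge0 ?mulr_ge0 ?subr_ge0 ?(ltW r1)//.
    rewrite exprMn sqr_sqrtr// (sqr_qnorm rT)// ltr_pdivrMr ?mulr_gt0//.
    by rewrite [ltRHS](_ : _ = 2 * s * (1 - r) ^+ 2 * rip x0 x0)//; ring.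
  have [j xj _] := yP _ gap0; rewrite y0 subr0 in xj.
  have := qnorm_geometric sT rT (fun=> I) (sqrtr_ge0 _) r01 (geo rip _ Bs0 rx) 0%N j.
  rewrite add0n expr0 -/L => xL.
  have := qnormD sT rT (u := x 0%N - x j) (v := x j) I I; rewrite subrK => x0le.
  have := hnorm_le_fnorm (Dx j); rewrite hnormE => xjle.
  have Lr : L * (1 - r ^+ j) <= L.
    by rewrite ler_piMr ?divr_ge0 ?sqrtr_ge0 ?subr_ge0 ?(ltW r1)// gerBl exprn_ge0.
  have x00 : x 0%N = x0 by [].
  rewrite x00 in x0le xL; lra.
split=> //; apply: (@Re_separates D (h y) (ip (m%:C%C *: y))).
- by move=> v Dv; exact: subspaceZ.
- by move=> v Dv; rewrite (hermZr sD hP).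
- by move=> v Dv; rewrite (ipZr ipP).
move=> v Dv; apply/eqP; rewrite -subr_eq0; apply/eqP.
have bE u : complex.Re (h u v) - complex.Re (ip (m%:C%C *: u) v) = b u v.
  by rewrite (ipZl ipP) Re_realM /b mulNr.
rewrite bE; pose l := `|m + (1 + eta)|.
apply: (small _ (s * qnorm rip v + (qnorm form_re v + l * qnorm rip v))).
  by rewrite !addr_ge0 ?mulr_ge0 ?sqrtr_ge0 ?normr_ge0 ?(ltW s0).
move=> eps eps0; have [j _ [xx' x'y]] := yP _ eps0.
(* The first term is s times the real part of <x_j - x_{j+1}, v>; the second is controlled by the
   form norm of x_{j+1} - y. Both are arbitrarily small. *)
have -> : b y v = b (x j.+1) v - b (x j.+1 - y) v.
  by rewrite -!bE scalerBr !(ipBl ipP) (hermBl sD hP)// !ReB; ring.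
apply: le_trans (ler_normB _ _) _; rewrite mulrDr; apply: lerD.
  have [_ xg _ _ _] := FP _ (Wx j).
  rewrite -bE -(rip_op xg Dv) -ReB -(ipBl ipP) addrC addKr -/(re_ip ip _ _) (psdZl rT)//.
  rewrite normrM gtr0_norm// mulrCA ler_pM2l//.
  apply: le_trans (yx_le _ _ (DB _ _ (Dx j) (Dx j.+1))) _.
  by rewrite ler_wpM2r// ltW.
have -> : b (x j.+1 - y) v = form_re (x j.+1 - y) v - (m + (1 + eta)) * rip (x j.+1 - y) v.
  by rewrite formE addrK.
apply: le_trans (ler_normB _ _) _; rewrite mulrDr; apply: lerD.
  apply: le_trans (psd_CSn sD qD (DB _ _ (Dx j.+1) Dy) Dv) _.
  by rewrite ler_wpM2r ?sqrtr_ge0// ltW.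
rewrite normrM -/l mulrCA ler_wpM2l ?normr_ge0//.
apply: le_trans (yx_le _ _ (DB _ _ (Dx j.+1) Dy)) _.
by rewrite ler_wpM2r// ltW.
Qed.

End Bottom.

(** * Lower bound of the form off the negative eigenvectors *)

Section NegativeSpectrum.
Set Implicit Arguments. Unset Strict Implicit.
Variables (R : realType) (V : lmodType R[i]) (ip : V -> V -> R[i]).
Hypothesis ipP : is_hilbert ip.
Variables (D : set V) (h : V -> V -> R[i]) (eta : R).
Hypotheses (sD : subspace D) (hP : hermitian_on D h).
Hypothesis hb : forall u, D u -> 0 <= complex.Re (h u u) + eta * re_ip ip u u.
Hypothesis h_closed : closed_form ip D h eta.
Local Notation rip := (re_ip ip).
Local Notation Hop := (assoc_op ip D h).

Let sT := @subspaceT R V.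
Let rT := rip_psd ipP sT.

Lemma eigenvalue_ge u (z : R) : u <> 0 -> Hop u (z%:C%C *: u) -> - eta <= z.
Proof.
move=> u0 uz; have Du : D u by case: uz.
have := hb Du; rewrite -(rip_op uz Du) (psdZl rT)// -mulrDl.
by rewrite pmulr_lge0 ?(rip_gt0 ipP)// -lerBlDr sub0r.
Qed.

(** Under discreteness a negative point outside the resolvent set is an eigenvalue, and eigenvalues
    are at least - eta. *)
Lemma resolvent_lt_bound (z : R) : discrete_neg_spectrum ip Hop ->
  z < - eta -> z < 0 -> in_resolvent ip Hop z%:C%C.
Proof.
move=> disc zeta z0; apply: contrapT => nres.
have [_ [u [g [u0 [ug gE]]]] _] := disc z z0 nres.
by rewrite gE in ug; have := eigenvalue_ge u0 ug; rewrite leNgt zeta.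
Qed.

Lemma rip_opp u : rip (- u) (- u) = rip u u.
Proof.
have -> : - u = (-1)%:C%C *: u by rewrite rmorphN rmorph1 scaleN1r.
by rewrite (psdZl rT)// (psdZr sT rT)// mulrA mulrNN mulr1 mul1r.
Qed.

Lemma shifted_gap (m : R) : discrete_neg_spectrum ip Hop -> m < 0 ->
  exists2 c, 0 < c & forall w g, 0 <= complex.Re (h w w) + (- m) * rip w w ->
    Hop w g -> c * (complex.Re (h w w) + (- m) * rip w w)
      <= rip (g - m%:C%C *: w) (g - m%:C%C *: w).
Proof.
move=> disc m0.
have bE w g : Hop w g -> complex.Re (h w w) + (- m) * rip w w = rip (g - m%:C%C *: w) w.
  move=> wg; have Dw : D w by case: wg.
  by rewrite -(rip_op wg Dw) /re_ip (ipBl ipP) (ipZl ipP) ReB Re_realM mulNr.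
have [/(resolvent_bound ipP)[k k0 kP]|/(disc m m0)[[d d0 dP] _ _]] :=
  pselect (in_resolvent ip Hop m%:C%C).
  (* In the resolvent case <G w, w>^2 <= |G w|^2 |w|^2 <= k |G w|^4 with G = H - m, and k <= (k +
     1)^2. *)
  exists (k + 1)^-1; first by rewrite invr_gt0 addr_gt0.
  move=> w g b0 wg; rewrite ler_pdivrMl ?addr_gt0//.
  have := kP _ _ wg; rewrite -(rip_opp (_ - g)) opprB => kw.
  have X0 := rip_ge0 ipP (g - m%:C%C *: w).
  rewrite -(@ler_pXn2r _ 2)// ?nnegrE ?mulr_ge0// ?addr_ge0 ?(ltW k0)//.
  rewrite {1}(bE _ _ wg); apply: le_trans (psd_CS sT rT I I) _.
  apply: (@le_trans _ _ (rip (g - m%:C%C *: w) (g - m%:C%C *: w) *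
      (k * rip (g - m%:C%C *: w) (g - m%:C%C *: w)))).
    by rewrite ler_wpM2l//.
  rewrite mulrCA exprMn -expr2 ler_wpM2r ?sqr_ge0//.
  by rewrite sqrrD expr1n mulr1 mulr2n -addrA -addrA addrC -addrA lerDl
    !addr_ge0 ?sqr_ge0 ?(ltW k0).
(* In the isolated case the open interval from m to m + 2 r lies in the resolvent set. [gap_bound]
   at its midpoint gives |(r - G) w|^2 >= r^2 |w|^2, which expands to |G w|^2 >= 2 r <G w, w>. *)
pose r := d / 2; have r0 : 0 < r by rewrite divr_gt0.
exists (2 * r); first by rewrite mulr_gt0.
move=> w g _ wg; rewrite (bE _ _ wg).
have res x : m + r - r < x < m + r + r -> in_resolvent ip Hop x%:C%C.
  move=> /andP[mx xm]; have mx' : m < x by lra.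
  have xd : x - m < d by move: xm; rewrite /r; lra.
  apply: dP; first by move=> /complexI xE; rewrite xE ltxx in mx'.
  by rewrite -rmorphB/= expr0n/= addr0 sqrtr_sqr gtr0_norm ?subr_gt0.
have := gap_bound ipP sD hP r0 res wg.
set y := g - m%:C%C *: w.
have -> : (m + r)%:C%C *: w - g = r%:C%C *: w - y.
  rewrite rmorphD/= scalerDl /y.
  by rewrite opprB addrA (addrC (r%:C%C *: w)).
rewrite (psdB sT rT)// (psdZl rT)// (psdZr sT rT)// (psdZl rT)//.
rewrite (psdC rT (u := w) (v := y))//; lra.
Qed.

(** Otherwise the infimum [m] of the Rayleigh quotient on the complement is below - eps, and
    [bottom_eigenvector] produces an eigenvector there that [no_eigen] excludes. *)
Lemma form_ge_on_compl n e mu (eps : R) : discrete_neg_spectrum ip Hop -> 0 <= eps ->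
  (forall i, (i < n)%N -> e i <> 0 /\ Hop (e i) ((mu i)%:C%C *: e i)) ->
  (forall x (m : R), m < - eps -> eigen_compl ip D n e x -> Hop x (m%:C%C *: x) -> x = 0) ->
  forall w, eigen_compl ip D n e w -> - eps * rip w w <= complex.Re (h w w).
Proof.
move=> disc eps0 eP no_eigen w0 Ww0; rewrite leNgt; apply/negP => lt0.
have w00 : 0 < rip w0 w0.
  apply: (rip_gt0 ipP) => w0E; move: lt0.
  by rewrite w0E (herm0l sD hP) ?/re_ip ?(ip0l ipP) ?mulr0 ?ltxx//; case: sD.
have [||m meta [mP mlt]] := @best_constant R V (eigen_compl ip D n e)
  (fun w => complex.Re (h w w)) (fun w => rip w w) (- eta) w0 _ _ Ww0 w00.
- by move=> *; exact: rip_ge0.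
- by move=> w [Dw _]; have := hb Dw; rewrite /= mulNr; lra.
have meps : m < - eps by rewrite -(ltr_pM2r w00); apply: le_lt_trans lt0; exact: mP.
have m0 : m < 0 by apply: lt_le_trans meps _; rewrite lerNl oppr0.
(* Takes m - s below - eta, hence into the resolvent set and away from every mu_i. *)
pose s := `|eta| + 1.
have s0 : 0 < s by rewrite ltr_wpDl.
have mseta : m - s < - eta by have := ler_norm eta; rewrite /s; lra.
have ms0 : m - s < 0 by lra.
have [c c0 cP] := shifted_gap disc m0.
have b0 w : eigen_compl ip D n e w -> 0 <= complex.Re (h w w) + (- m) * rip w w.
  by move=> Ww; rewrite mulNr subr_ge0; exact: mP.
have [||||x Wx [x0 xm]] := @bottom_eigenvector R V ip ipP D h eta sD hP hb h_closed
    n e mu _ m s c s0 c0 b0 _ (resolvent_lt_bound disc mseta ms0) _ _.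
- by move=> i /eP[].
- move=> tau tau0; have [w Ww wlt] := mlt _ tau0; exists w => //.
  by rewrite mulNr ltrBlDr -mulrDl (addrC tau).
- move=> i /eP[ei0 ei]; apply/eqP => muE.
  by have := eigenvalue_ge ei0 ei; rewrite muE leNgt mseta.
- by move=> w g Ww wg; apply: cP => //; exact: b0.
exact: x0 (no_eigen _ _ meps Wx xm).
Qed.

End NegativeSpectrum.

(** * Orthonormal eigenvector families and the trace *)

Section Trace.
Set Implicit Arguments. Unset Strict Implicit.
Variables (R : realType) (V : lmodType R[i]) (ip : V -> V -> R[i]).
Hypothesis ipP : is_hilbert ip.
Variable Op : V -> V -> Prop.

Definition eigenfamily (eps : R) n (e : nat -> V) (mu : nat -> R) : Prop :=
  orthonormal ip n e /\
  forall i, (i < n)%N -> Op (e i) ((mu i)%:C%C *: e i) /\ mu i < - eps.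

Lemma orthonormal_neq0 n e i : orthonormal ip n e -> (i < n)%N -> e i <> 0.
Proof.
move=> on ilt ei0; have := on i i ilt ilt; rewrite eqxx ei0 (ip0l ipP) => /esym/eqP.
by rewrite oner_eq0.
Qed.

Lemma orthonormal_lin_indep n e m (f : 'I_m -> nat) : orthonormal ip n e ->
  (forall i, (f i < n)%N) -> injective f -> lin_indep (fun i => e (f i)).
Proof.
move=> on fn fI c c0 i; have := ip0l ipP (e (f i)); rewrite -c0 (ip_suml ipP).
rewrite (bigD1 i)//= on// eqxx mulr1 big1 ?addr0// => j ji.
by rewrite on// (inj_eq fI) (negbTE ji) mulr0.
Qed.

Lemma mult_ge_card n e (mu : nat -> R) (x : R) : orthonormal ip n e ->
  (forall i, (i < n)%N -> Op (e i) ((mu i)%:C%C *: e i)) ->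
  ((#|[pred i : 'I_n | mu i == x]|%:R)%:E <= mult_ereal Op x%:C%C)%E.
Proof.
move=> on eP; apply: ereal_sup_ubound; set P := [pred i : 'I_n | _]; exists #|P| => //.
exists (fun j : 'I_#|P| => e (enum_val j)); split; last first.
  apply: (orthonormal_lin_indep on) => // i j /val_inj; exact: enum_val_inj.
move=> j; exists 0; split=> //; have := enum_valP j; rewrite inE => /eqP mux.
by exists (x%:C%C *: e (enum_val j)); rewrite subrr; split=> //; rewrite -mux; exact: eP.
Qed.

(** The family is grouped by its distinct eigenvalues [s]. Each occurs at most as often as its
    multiplicity, by independence, and [s] is one of the finite sets over which the sum is a
    supremum. *)
Lemma eigenfamily_trace n e mu (gamma eps : R) : 0 <= eps -> eigenfamily eps n e mu ->
  ((\sum_(i < n) (- mu i) `^ gamma)%:E <= neg_trace Op gamma)%E.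
Proof.
move=> eps0 [on eP]; pose s := undup [seq mu (val i) | i <- enum 'I_n].
have sU : uniq s by exact: undup_uniq.
apply: esum_ge; exists [set` s].
  split; first exact: finite_seq.
  move=> x /=; rewrite mem_undup => /mapP[i _ ->].
  have [ei mui] := eP i (ltn_ord i); split; first by apply: lt_le_trans mui _; rewrite lerNl oppr0.
  by exists (e i), ((mu i)%:C%C *: e i); split=> //; exact: (orthonormal_neq0 on).
rewrite -fsbig_seq//=.
have -> : \sum_(i < n) (- mu i) `^ gamma
    = \sum_(x <- s) #|[pred i : 'I_n | mu i == x]|%:R * (- x) `^ gamma.
  transitivity (\sum_(i < n) \sum_(x <- s | mu i == x) (- x) `^ gamma).
    apply: eq_bigr => i _; rewrite -big_filter (_ : [seq _ <- s | _] = [:: mu i]) ?big_seq1//.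
    rewrite (eq_filter (a2 := pred1 (mu i))); last by move=> x; rewrite /= eq_sym.
    by rewrite filter_pred1_uniq// mem_undup; apply/mapP; exists i => //; rewrite mem_enum.
  rewrite (exchange_big_dep xpredT)//=; apply: eq_bigr => x _.
  by rewrite sumr_const mulr_natl.
rewrite -sumEFin; apply: lee_sum => x _; rewrite EFinM.
apply: lee_wpmul2r; first by rewrite lee_fin powR_ge0.
by apply: (mult_ge_card _ on) => i /eP[].
Qed.

Lemma eigenfamily_extend (eps : R) n e mu x (m : R) :
  (forall (c : R[i]) u f, Op u f -> Op (c *: u) (c *: f)) ->
  eigenfamily eps n e mu -> m < - eps -> x <> 0 -> Op x (m%:C%C *: x) ->
  (forall i, (i < n)%N -> ip x (e i) = 0) ->
  exists e' mu', eigenfamily eps n.+1 e' mu'.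
Proof.
move=> opZ [on eP] meps x0 xm xe; have [c c0 xc] := normalize ipP x0.
exists (extend n e (c%:C%C *: x)), (extend n mu m); split.
  apply: orthonormal_extend => // i ilt.
  by rewrite (ipZl ipP) xe ?mulr0.
move=> i; rewrite ltnS leq_eqVlt => /orP[/eqP->|ilt]; last by rewrite !extend_lt//; exact: eP.
rewrite !extend_eq; split => //.
by rewrite scalerA mulrC -scalerA; exact: opZ.
Qed.

(** If every family could be extended, there would be families of every length n, each forcing the
    trace to be at least n eps^gamma. *)
Lemma maximal_eigenfamily (gamma eps : R) :
  (forall (c : R[i]) u f, Op u f -> Op (c *: u) (c *: f)) ->
  0 <= gamma -> 0 < eps -> (neg_trace Op gamma < +oo)%E ->
  exists n e mu, eigenfamily eps n e mu /\
    forall x (m : R), m < - eps -> Op x (m%:C%C *: x) ->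
      (forall i, (i < n)%N -> ip x (e i) = 0) -> x = 0.
Proof.
move=> opZ gamma0 eps0 tr; apply: contrapT => nmax.
have fam n : exists e mu, eigenfamily eps n e mu.
  elim: n => [|n [e [mu emu]]]; first by exists (fun=> 0), (fun=> 0).
  apply: contrapT => next; apply: nmax; exists n, e, mu; split=> // x m meps xm xe.
  apply: contrapT => x0; apply: next.
  exact: (eigenfamily_extend opZ emu meps x0 xm xe).
have epsg : 0 < eps `^ gamma by exact: powR_gt0.
have neps n : ((n%:R * eps `^ gamma)%:E <= neg_trace Op gamma)%E.
  have [e [mu emu]] := fam n; apply: le_trans (eigenfamily_trace gamma (ltW eps0) emu).
  rewrite lee_fin mulr_natl -[n in X in X <= _]card_ord -sumr_const.
  apply: ler_sum => i _; case: emu => _ /(_ i (ltn_ord i))[_ mui].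
  have epsmu : eps <= - mu i by rewrite lerNr ltW.
  by apply: ge0_ler_powR => //; rewrite nnegrE ?ltW//; apply: lt_le_trans epsmu.
case: (neg_trace Op gamma) tr neps => [t| |]//= _ neps.
  have := neps (Num.truncn (t / eps `^ gamma)).+1.
  by rewrite lee_fin leNgt -ltr_pdivrMr// truncnS_gt.
by have := neps 0%N.
Qed.

End Trace.

(** * Schur bases from generalised eigenvectors *)

Section Schur.
Set Implicit Arguments. Unset Strict Implicit.
Variables (R : realType) (V : lmodType R[i]) (ip : V -> V -> R[i]).
Hypothesis ipP : is_hilbert ip.
Variable Op : V -> V -> Prop.
Hypothesis op0 : Op 0 0.
Hypothesis opL : forall (c : R[i]) u v f g, Op u f -> Op v g -> Op (c *: u + v) (c *: f + g).
Hypothesis op_fun : forall u f g, Op u f -> Op u g -> f = g.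

Definition lincomb n (u : nat -> V) (c : nat -> R[i]) : V := \sum_(i < n) c i *: u i.

(** The operator is upper triangular in [u], with diagonal [l]: [lincomb j] involves only the
    vectors before [u j]. *)
Definition schur_family n (u : nat -> V) (l : nat -> R[i]) : Prop :=
  orthonormal ip n u /\
  forall j, (j < n)%N -> exists c, Op (u j) (l j *: u j + lincomb j u c).

Lemma lincombS n u c : lincomb n.+1 u c = lincomb n u c + c n *: u n.
Proof. by rewrite /lincomb big_ord_recr. Qed.

Lemma eq_lincomb n u u' c c' : (forall i, (i < n)%N -> c i = c' i /\ u i = u' i) ->
  lincomb n u c = lincomb n u' c'.
Proof. by move=> cc'; apply: eq_bigr => i _; have [-> ->] := cc' i (ltn_ord i). Qed.

Lemma lincombD n u c d (a : R[i]) :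
  a *: lincomb n u c + lincomb n u d = lincomb n u (fun i => a * c i + d i).
Proof.
rewrite /lincomb scaler_sumr -big_split/=; apply: eq_bigr => i _.
by rewrite scalerA scalerDl.
Qed.

Lemma lincombZ n u c (a : R[i]) : a *: lincomb n u c = lincomb n u (fun i => a * c i).
Proof. by rewrite /lincomb scaler_sumr; apply: eq_bigr => i _; rewrite scalerA. Qed.

(** By triangularity the span of the first [k] vectors is invariant and the last coefficient is
    multiplied by its diagonal entry; for k = 0 there is no such coefficient. *)
Lemma op_lincomb n u l k c : schur_family n u l -> (k <= n)%N ->
  exists2 c', Op (lincomb k u c) (lincomb k u c') & forall j, k = j.+1 -> c' j = l j * c j.
Proof.
move=> [_ uP]; elim: k => [|k IH] kn.
  by exists (fun=> 0) => //; rewrite /lincomb !big_ord0.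
have [c' opc' _] := IH (ltnW kn); have [d opd] := uP k kn.
exists (extend k (fun i => c k * d i + c' i) (l k * c k)); last first.
  by move=> j [<-]; rewrite extend_eq.
rewrite !lincombS extend_eq addrC; have := opL (c k) opd opc'.
congr Op; rewrite scalerDr scalerA [c k * l k]mulrC -addrA lincombD addrC; congr (_ + _).
by apply: eq_lincomb => i ik; rewrite extend_lt.
Qed.

Lemma shifted_lincomb n u l z j c w : schur_family n u l -> (j < n)%N ->
  shifted Op z (lincomb j.+1 u c) w ->
  exists2 c', w = lincomb j.+1 u c' & c' j = (z - l j) * c j.
Proof.
move=> us jn [g [og ->]]; have [c' oc' c'j] := op_lincomb c us jn.
rewrite (op_fun og oc'); exists (fun i => z * c i + - c' i).
  rewrite -lincombD; congr (_ + _).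
  by rewrite -scaleN1r lincombZ; apply: eq_lincomb => i _; rewrite mulN1r.
by rewrite c'j// mulrBl.
Qed.

Lemma ip_lincomb n u c j : orthonormal ip n u -> (j < n)%N -> ip (lincomb n u c) (u j) = c j.
Proof. exact: ip_orthonormal_sum. Qed.

Lemma orthonormal_le n k u : (k <= n)%N -> orthonormal ip n u -> orthonormal ip k u.
Proof. by move=> kn on i j ik jk; apply: on; exact: leq_trans kn. Qed.

(** Each application of z - Op multiplies the top coefficient by z - l_j, which is nonzero. *)
Lemma ker_pow_top n u l z k j c : schur_family n u l -> (j < n)%N -> l j != z ->
  ker_pow Op z k (lincomb j.+1 u c) -> c j = 0.
Proof.
move=> us jn ljz; elim: k c => [|k IH] c /=.
  have on := orthonormal_le jn us.1.
  by move=> c0; rewrite -(ip_lincomb c on (ltnSn j)) c0 (ip0l ipP).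
move=> [w [/(shifted_lincomb us jn)[c' -> c'j] /IH]]; rewrite c'j => /eqP.
by rewrite mulf_eq0 subr_eq0 eq_sym (negbTE ljz) => /eqP.
Qed.

Lemma ker_pow_lincomb_eq0 n u l z k c : schur_family n u l ->
  (forall i, (i < n)%N -> l i = z -> c i = 0) ->
  ker_pow Op z k (lincomb n u c) -> lincomb n u c = 0.
Proof.
move=> us c0; suff P j : (j <= n)%N -> ker_pow Op z k (lincomb j u c) -> lincomb j u c = 0.
  exact: P.
elim: j => [|j IH] jn kj; first by rewrite /lincomb big_ord0.
have cj : c j = 0.
  by have [/(c0 j jn)//|ljz] := eqVneq (l j) z; exact: ker_pow_top us jn ljz kj.
rewrite lincombS cj scale0r addr0; apply: IH; first exact: ltnW.
by move: kj; rewrite lincombS cj scale0r addr0.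
Qed.

Lemma subspace_ker_pow z k : subspace (ker_pow Op z k).
Proof.
elim: k => [|k [IH0 IHL]]; first by split=> // c u v -> ->; rewrite scaler0 addr0.
split; first by exists 0; split=> //; exists 0; rewrite scaler0 subr0.
move=> c u v [w [[g [ug ->]] kw]] [w' [[g' [vg' ->]] kw']].
exists (c *: (z *: u - g) + (z *: v - g')); split; last exact: IHL.
exists (c *: g + g'); split; first exact: opL.
by rewrite scalerBr scalerDr opprD addrACA !scalerA mulrC.
Qed.

Definition in_span n (u : nat -> V) x := x = proj ip n u x.

Lemma proj_lincomb n u x : proj ip n u x = lincomb n u (fun i => ip x (u i)).
Proof. by []. Qed.

Lemma subspace_in_span n u : subspace (in_span n u).
Proof.
split; first by rewrite /in_span /proj big1// => i _; rewrite (ip0l ipP) scale0r.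
move=> c x y xs ys; rewrite /in_span {1}xs {1}ys !proj_lincomb lincombD.
by apply: eq_lincomb => i _; rewrite (ipDl ipP) (ipZl ipP).
Qed.

(** With more vectors than diagonal entries equal to [z], a nontrivial combination has zero
    coefficients at all these positions; by [ker_pow_lincomb_eq0] it vanishes. *)
Lemma ker_pow_dim n u l z k q (v : 'I_q -> V) : schur_family n u l ->
  (forall i, ker_pow Op z k (v i)) -> (forall i, in_span n u (v i)) -> lin_indep v ->
  (q <= #|[pred i : 'I_n | l i == z]|)%N.
Proof.
move=> us kv sv vI; set P := [pred i : 'I_n | _]; rewrite leqNgt; apply/negP => Pq.
pose M : 'M[R[i]]_(q, #|P|) := \matrix_(i < q, j < #|P|) ip (v i) (u (enum_val j)).
have : kermx M != 0.
  by rewrite kermx_eq0 /row_free neq_ltn (leq_ltn_trans (rank_leq_col M) Pq).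
case/rowV0Pn => d /sub_kermxP dM d0.
pose x := \sum_i d 0 i *: v i.
have kx : ker_pow Op z k x.
  apply: (subspace_sum (subspace_ker_pow z k)) => i.
  exact: subspaceZ (subspace_ker_pow z k) (kv i).
have sx : in_span n u x.
  apply: (subspace_sum (subspace_in_span n u)) => i.
  exact: subspaceZ (subspace_in_span n u) (sv i).
have x0 : x = 0.
  rewrite sx proj_lincomb; apply: (ker_pow_lincomb_eq0 (z := z) (k := k) us).
    move=> i ilt liz; have iP : Ordinal ilt \in P by rewrite inE /= liz.
    have /rowP/(_ (enum_rank_in iP (Ordinal ilt))) := dM.
    rewrite !mxE => <-; rewrite (ip_suml ipP); apply: eq_bigr => j _.
    by rewrite mxE enum_rankK_in.
  by rewrite -proj_lincomb -sx.
by move/eqP: d0; apply; apply/rowP => i; rewrite mxE; exact: vI x0 i.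
Qed.

(** Repeated application of z - Op leads from v to 0, which is in the span; v' is the last vector of
    this chain outside it. *)
Lemma last_outside_span n u z k v : ker_pow Op z k v -> ~ in_span n u v ->
  exists v' w, [/\ ~ in_span n u v', shifted Op z v' w & in_span n u w].
Proof.
elim: k v => [|k IH] v /=; first by move=> ->; case: (subspace_in_span n u).
move=> [w [vw kw]] nv; have [sw|] := pselect (in_span n u w); first by exists v, w.
exact: IH.
Qed.

Lemma schur_extend n u l z k q : schur_family n u l -> dim_ge (ker_pow Op z k) q ->
  (#|[pred i : 'I_n | l i == z]| < q)%N ->
  exists x, schur_family n.+1 (extend n u x) (extend n l z).
Proof.
move=> us [v [kv vI]] nq.
have [i nvi] : exists i, ~ in_span n u (v i).
  apply: contrapT => nex; move: nq; rewrite ltnNge (ker_pow_dim us kv _ vI)// => i.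
  by apply: contrapT => nvi; apply: nex; exists i.
have [y [w [ny [g [yg wE]] sw]]] := last_outside_span (kv i) nvi.
pose p := proj ip n u y; pose y' := y - p.
have y0 : y' <> 0 by move/eqP; rewrite subr_eq0 => /eqP.
have [c opc _] := op_lincomb (fun i => ip y (u i)) us (leqnn n).
have [t _ tE] := normalize ipP y0.
have [on uP] := us; exists (t%:C%C *: y'); split.
  apply: orthonormal_extend => // j jn.
  by rewrite (ipZl ipP) (ip_residual ipP)// mulr0.
move=> j; rewrite ltnS leq_eqVlt => /orP[/eqP->|jn]; last first.
  rewrite !extend_lt//; have [d opd] := uP j jn; exists d.
  rewrite (eq_lincomb (c' := d) (u' := u))// => i0 i0j; rewrite extend_lt//.
  exact: ltn_trans jn.
pose d i := z * ip y (u i) - c i - ip w (u i).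
(* Since Op y = z y - w and y' = y - p, the image of y' is z y' plus z p - Op p - w, and all three
   of these terms lie in the span. *)
have opy : Op y' (z *: y' + lincomb n u d).
  have -> : lincomb n u d = z *: p - lincomb n u c - w.
    rewrite {1}sw /p !proj_lincomb lincombZ /lincomb -!sumrB.
    by apply: eq_bigr => i0 _; rewrite !scalerBl.
  have := opL (-1) opc yg; rewrite -proj_lincomb -/p !scaleN1r addrC.
  congr Op; rewrite wE opprB /y' scalerBr.
  by rewrite (AC (2*(2*2)) ((1*6)*(2*3)*(4*5)))/= subrr addNr !add0r.
exists (fun i => t%:C%C * d i); rewrite !extend_eq.
have := opL t%:C%C opy op0; rewrite !addr0; congr Op.
rewrite scalerDr !scalerA mulrC lincombZ; congr (_ + _).
by apply: eq_lincomb => i0 i0n; rewrite extend_lt.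
Qed.

(** The entries of [lam] are added one at a time. The earlier copies of an entry are fewer than all
    its copies, and these are within the algebraic multiplicity, so [schur_extend] applies. *)
Lemma schur_exists N (lam : 'I_N -> R[i]) :
  (forall j, alg_mult_ge Op (lam j) #|[pred k | lam k == lam j]|) ->
  exists u l, schur_family N u l /\ forall j : 'I_N, l j = lam j.
Proof.
move=> am; suff P n : (n <= N)%N ->
    exists u l, schur_family n u l /\ forall j : 'I_N, (j < n)%N -> l j = lam j.
  by have [u [l [us ul]]] := P N (leqnn N); exists u, l; split=> // j; exact: ul.
elim: n => [|n IH] nN; first by exists (fun=> 0), (fun=> 0).
have [u [l [us ul]]] := IH (ltnW nN).
have [k kq] := am (Ordinal nN).
have [|x xs] := schur_extend us kq.
  (* The earlier positions with the same value inject into all positions with that value and miss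
     position n itself. *)
  pose f := widen_ord (ltnW nN).
  have fI : injective f by move=> i j /(congr1 val)/= /val_inj.
  rewrite -(fintype.card_image fI).
  apply: proper_card; apply/properP; split.
    apply/fintype.subsetP => j /fintype.imageP[i + ->]; rewrite !inE => /eqP <-.
    by rewrite -ul//= eqxx.
  exists (Ordinal nN); first by rewrite inE eqxx.
  apply/negP => /fintype.imageP[i _ /(congr1 val)/= ni].
  by have := ltn_ord i; rewrite -ni ltnn.
exists (extend n u x), (extend n l (lam (Ordinal nN))); split=> // j.
rewrite ltnS leq_eqVlt => /orP[/eqP jn|jn]; last by rewrite extend_lt ?ul.
by rewrite jn extend_eq; congr lam; apply: val_inj.
Qed.

End Schur.

(** * Jensen's inequality for powers *)

Section Jensen.
Set Implicit Arguments. Unset Strict Implicit.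
Variable R : realType.

Lemma powR_jensen n (p a : nat -> R) (gamma : R) : 1 <= gamma ->
  (forall i, (i < n)%N -> 0 <= p i /\ 0 <= a i) -> \sum_(i < n) p i = 1 ->
  (\sum_(i < n) p i * a i) `^ gamma <= \sum_(i < n) p i * a i `^ gamma.
Proof.
move=> g1 pa p1; set t := \sum_(i < n) p i * a i.
have t0 : 0 <= t.
  by apply: sumr_ge0 => i _; have [pi0 ai0] := pa i (ltn_ord i); rewrite mulr_ge0.
have [<-|gN1] := eqVneq 1 gamma.
  rewrite powRr1// /t; apply: ler_sum => i _.
  by have [pi0 ai0] := pa i (ltn_ord i); rewrite powRr1.
have g0 : 0 < gamma by apply: lt_le_trans g1.
have [t00|tN0] := eqVneq t 0.
  rewrite t00 powR0 ?gt_eqF//; apply: sumr_ge0 => i _.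
  by have [pi0 ai0] := pa i (ltn_ord i); rewrite mulr_ge0// powR_ge0.
have gm0 : 0 < gamma - 1 by rewrite subr_gt0 lt_neqAle gN1.
(* Young's inequality with conjugate exponents gamma and q is applied to each product a_i b. As b^q
   = t b = t^gamma, averaging gives t^gamma <= S / gamma + t^gamma / q, where S is the right-hand
   side of the claim, and so t^gamma <= S. *)
pose b := t `^ (gamma - 1); pose q := gamma / (gamma - 1).
have q0 : 0 < q by rewrite divr_gt0.
have bq : b `^ q = t `^ gamma.
  by rewrite -powRrM; congr (_ `^ _); rewrite /q; field; rewrite gt_eqF.
have tb : t * b = t `^ gamma.
  rewrite -{1}(powRr1 t0) /b -powRD; first by congr (_ `^ _); ring.
  by rewrite tN0 implybT.
have gq : gamma^-1 + q^-1 = 1 by rewrite /q; field; rewrite !gt_eqF.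
have young i : (i < n)%N -> p i * a i * b <= p i * a i `^ gamma / gamma + p i * (t `^ gamma / q).
  move=> ilt; have [pi0 ai0] := pa i ilt.
  rewrite -!mulrA -mulrDr; apply: ler_wpM2l => //.
  by rewrite -bq; apply: conjugate_powR => //; exact: powR_ge0.
have : t * b <= (\sum_(i < n) p i * a i `^ gamma) / gamma + t `^ gamma / q.
  rewrite -[X in _ + X]mul1r -p1 !mulr_suml -big_split/=.
  by apply: ler_sum => i _; rewrite -mulrA mulrA; exact: young.
rewrite tb; have qE : q^-1 = 1 - gamma^-1 by move: gq; lra.
rewrite qE mulrBr mulr1 addrCA lerDl subr_ge0 ler_pM2r ?invr_gt0//.
Qed.

End Jensen.

(** * The sesquilinear form, its symmetric part and its operator *)

Section FormOperators.
Set Implicit Arguments. Unset Strict Implicit.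
Variables (R : realType) (V : lmodType R[i]) (ip : V -> V -> R[i]).
Hypothesis ipP : is_hilbert ip.
Variables (D : set V) (a : V -> V -> R[i]).
Hypotheses (aP : is_sesquilinear_form D a).
Local Notation rip := (re_ip ip).

Lemma subspace_dom : subspace D.
Proof. by case: aP. Qed.

Lemma sym_part_hermitian : hermitian_on D (sym_part a).
Proof.
case: aP => D0 DL al ar; have sD := subspace_dom; split=> [c u v w Du Dv Dw|u v Du Dv].
  rewrite /sym_part al// ar// rmorphD/= rmorphM/= conjcK.
  by rewrite mulrA -mulrDl; congr (_ / _); ring.
rewrite /sym_part rmorphM fmorphV rmorph_nat rmorphD/= conjcK.
by rewrite addrC.
Qed.

Lemma Re_sym_part u : complex.Re (sym_part a u u) = complex.Re (a u u).
Proof. by rewrite /sym_part -ReJ_add. Qed.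

Lemma sym_part_closed eta : closed_form ip D a eta -> closed_form ip D (sym_part a) eta.
Proof.
have E u : fnorm ip (sym_part a) eta u = fnorm ip a eta u by rewrite /fnorm Re_sym_part.
move=> ac s Ds cau; have [|x Dx sx] := ac s Ds.
  move=> e e0; have [N NP] := cau e e0; exists N => n m Nn Nm.
  by rewrite -E; exact: NP.
by exists x => // e e0; have [N NP] := sx e e0; exists N => n Nn; rewrite E; exact: NP.
Qed.

Lemma assoc_op0 : assoc_op ip D a 0 0.
Proof.
case: aP => D0 _ al _; split=> // v Dv; rewrite (ip0l ipP).
by have /eqP := al 1 0 0 v D0 D0 Dv;
  rewrite scaler0 addr0 mul1r -subr_eq0 opprD addrA subrr sub0r oppr_eq0 => /eqP.
Qed.

Lemma assoc_op_linear (c : R[i]) u v f g : assoc_op ip D a u f -> assoc_op ip D a v g ->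
  assoc_op ip D a (c *: u + v) (c *: f + g).
Proof.
case: aP => D0 DL al _ [Du uf] [Dv vg]; split; first exact: DL.
by move=> w Dw; rewrite al// uf// vg// (ipDl ipP) (ipZl ipP).
Qed.

(** The difference x = f - g is orthogonal to the dense domain; a v in the domain within |x| of x
    would give |x|^2 <= |x| |x - v| < |x|^2. *)
Lemma assoc_op_fun u f g : densely_defined ip D ->
  assoc_op ip D a u f -> assoc_op ip D a u g -> f = g.
Proof.
move=> dense [Du uf] [_ ug]; apply/eqP; rewrite -subr_eq0; apply/eqP.
set x := f - g; apply: contrapT => x0.
have sT := @subspaceT R V; have rT := rip_psd ipP sT.
have xn0 : 0 < hnorm ip x by rewrite sqrtr_gt0; exact: rip_gt0.
have [v Dv xv] := dense x _ xn0.
have ipxv : rip x v = 0 by rewrite /re_ip (ipBl ipP) -uf// -ug// subrr.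
have : rip x x <= hnorm ip x * hnorm ip (x - v).
  apply: le_trans (psd_CSn sT rT (u := x) (v := x - v) I I).
  apply: le_trans (ler_norm _).
  by rewrite /re_ip (hermBr sT (ip_hermitian ipP setT))// ReB -!/(re_ip ip _ _) ipxv subr0.
by rewrite -(sqr_hnorm ipP) expr2 ler_pM2l// leNgt xv.
Qed.

(** a(u_j, u_j) = <A u_j, u_j>, and orthogonality removes the terms before u_j. *)
Lemma schur_diagonal n u l j : schur_family ip (assoc_op ip D a) n u l -> (j < n)%N ->
  D (u j) /\ a (u j) (u j) = l j.
Proof.
move=> [on uP] jn; have [c [Du ->//]] := uP j jn; split=> //.
rewrite (ipDl ipP) (ipZl ipP) on// eqxx mulr1 /lincomb (ip_suml ipP) big1 ?addr0//.
move=> i _; have ij := ltn_ord i.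
by rewrite on ?ltn_eqF ?mulr0//; exact: ltn_trans jn.
Qed.

End FormOperators.

Theorem theorem1 (R : realType) (V : lmodType R[i]) (ip : V -> V -> R[i])
    (D : set V) (a : V -> V -> R[i]) :
  is_hilbert ip ->
  is_sesquilinear_form D a ->
  densely_defined ip D ->
  (exists eta : R, [/\ bounded_below_by ip D a eta,
                       continuous_form ip D a eta & closed_form ip D a eta]) ->
  let A := assoc_op ip D a in
  let H := assoc_op ip D (sym_part a) in
  ((forall mu : R, mu < 0 -> in_resolvent ip H (mu%:C)%C) ->
     forall z : R[i], complex.Re z < 0 -> ~ is_eigenvalue A z)
  /\
  (discrete_neg_spectrum ip H ->
     forall (N : nat) (lam : 'I_N -> R[i]),
       (forall j, is_eigenvalue A (lam j) /\ complex.Re (lam j) < 0) ->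
       (forall j, alg_mult_ge A (lam j) #|[pred k | lam k == lam j]|) ->
       forall gamma : R, 1 <= gamma ->
       (\sum_(k < N) (((- complex.Re (lam k)) `^ gamma)%R)%:E
          <= neg_trace H gamma)%E).
Proof.
move=> ipP aP dense [eta [ab _ ac]] A H.
have sD := subspace_dom aP; have hP := sym_part_hermitian aP.
have hc := sym_part_closed ac.
have hb u : D u -> 0 <= complex.Re (sym_part a u u) + eta * re_ip ip u u.
  by move=> Du; rewrite Re_sym_part -(sqr_hnorm ipP); exact: ab.
split=> [res z z0 [u [g [u0 [[Du ug] gE]]]]|disc N lam lamP amP gamma g1].
  have disc : discrete_neg_spectrum ip H by move=> mu mu0 []; exact: res.
  (* With the empty family, [form_ge_on_compl] gives h(u, u) >= (Re z / 2) |u|^2, while the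
     eigenvector satisfies h(u, u) = Re z |u|^2. *)
  pose eps := - complex.Re z / 2.
  have eps0 : 0 <= eps by rewrite /eps; lra.
  have noeig x (m : R) : m < - eps -> eigen_compl ip D 0 (fun=> 0) x ->
      H x (m%:C%C *: x) -> x = 0.
    move=> meps _ xm; have [|_ inj _] := res m.
      by apply: lt_le_trans meps _; rewrite lerNl oppr0.
    by apply: (inj _ _ xm); rewrite subrr.
  have := @form_ge_on_compl _ _ _ ipP _ _ _ sD hP hb hc 0 (fun=> 0) (fun=> 0) _ disc eps0
    (fun i i0 => False_ind _ (notF i0)) noeig u (conj Du (fun i i0 => False_ind _ (notF i0))).
  rewrite Re_sym_part ug// gE (ipZl ipP) (ip_diag ipP) [z * _]mulrC Re_realM.
  have := rip_gt0 ipP u0; rewrite /eps; nra.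
have [->|trN] := eqVneq (neg_trace H gamma) +oo%E; first exact: leey.
have tr : (neg_trace H gamma < +oo)%E by rewrite ltey.
have g0 : 0 <= gamma by apply: le_trans g1.
have [u [l [us ul]]] := schur_exists ipP (assoc_op0 ipP aP) (assoc_op_linear ipP aP)
  (fun u f g => @assoc_op_fun _ _ _ ipP _ a u f g dense) amP.
apply/lee_addgt0Pr => d d0.
(* The bound 1 yields eps^gamma <= eps, and d / (N + 1) keeps the total error N eps below d, also
   for N = 0. *)
pose eps := Num.min 1 (d / N.+1%:R).
have eps0 : 0 < eps by rewrite lt_min ltr01/= divr_gt0.
have eps1 : eps <= 1 by rewrite ge_min lexx.
have epsd : N%:R * eps <= d.
  apply: (@le_trans _ _ (N.+1%:R * eps)); first by rewrite ler_pM2r// ler_nat.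
  by rewrite mulrC -ler_pdivlMr// ge_min lexx orbT.
have hL c u0 f : H u0 f -> H (c *: u0) (c *: f).
  move=> u0f; have := op_linear ipP sD hP c u0f (v := 0) (g := 0).
  rewrite !addr0; apply; split; first by case: sD.
  by move=> v Dv; rewrite (herm0l sD hP)// (ip0l ipP).
have [n [e [mu [emu nomore]]]] := maximal_eigenfamily ipP hL g0 eps0 tr.
have [on eP] := emu.
have hge : forall w, eigen_compl ip D n e w -> - eps * re_ip ip w w <= complex.Re (sym_part a w w).
  apply: (form_ge_on_compl ipP sD hP hb hc (mu := mu) disc (ltW eps0)).
    by move=> i ilt; split; [exact: (orthonormal_neq0 ipP on)|case: (eP i ilt)].
  by move=> x m meps [_ xe] xm; exact: nomore meps xm xe.
have De i : (i < n)%N -> D (e i) by move=> /eP[[]].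
have bound (k : 'I_N) : (- complex.Re (lam k)) `^ gamma
    <= \sum_(i < n) normsq (ip (u k) (e i)) * (- mu i) `^ gamma + eps.
  have [Duk auk] := schur_diagonal ipP us (ltn_ord k).
  pose w := u k - proj ip n e (u k).
  have Ww : eigen_compl ip D n e w.
    by split; [exact: (residual_subspace _ sD De Duk)|move=> i ilt; exact: (ip_residual ipP)].
  have ruk : re_ip ip (u k) (u k) = 1 by rewrite /re_ip us.1// eqxx.
  have p1 := pythagoras ipP (u k) on; rewrite ruk -/w in p1.
  have w1 : re_ip ip w w <= 1 by rewrite p1 lerDr sumr_ge0// => i _; exact: normsq_ge0.
  have lamE : complex.Re (lam k) = \sum_(i < n) mu i * normsq (ip (u k) (e i))
      + complex.Re (sym_part a w w).
    rewrite -ul -auk -Re_sym_part; apply: (@herm_decomposition _ _ _ ipP D _ n e mu (u k) sD hP on De _ Duk).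
    by move=> i v /eP[[_ ei] _] Dv; rewrite ei// (ipZl ipP).
  (* Weights for Jensen: |<u_k, e_i>|^2 at the value - mu_i, and one extra entry of weight |w|^2 at
     the value eps for the component orthogonal to all e_i. By Pythagoras they add up to 1. *)
  pose p i := extend n (fun i => normsq (ip (u k) (e i))) (re_ip ip w w) i.
  pose c i := extend n (fun i => - mu i) eps i.
  have pS : \sum_(i < n.+1) p i = 1.
    rewrite big_ord_recr/= /p extend_eq p1; congr (_ + _).
    by apply: eq_bigr => i _; rewrite extend_lt.
  have pcE f : \sum_(i < n.+1) p i * f (c i)
      = \sum_(i < n) normsq (ip (u k) (e i)) * f (- mu i) + re_ip ip w w * f eps.
    rewrite big_ord_recr/= /p /c !extend_eq; congr (_ + _).
    by apply: eq_bigr => i _; rewrite !extend_lt.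
  have pc0 i : (i < n.+1)%N -> 0 <= p i /\ 0 <= c i.
    rewrite ltnS leq_eqVlt => /orP[/eqP->|ilt]; rewrite /p /c.
      by rewrite !extend_eq (rip_ge0 ipP) ltW.
    rewrite !extend_lt// normsq_ge0; split=> //; have [_ mui] := eP i ilt.
    by rewrite lerNr oppr0; apply: ltW; apply: lt_trans mui _; rewrite ltrNl oppr0.
  have le1 : - complex.Re (lam k) <= \sum_(i < n.+1) p i * c i.
    rewrite (pcE id) lamE opprD -sumrN; apply: lerD.
      by apply: ler_sum => i _; rewrite mulrN mulrC.
    by rewrite lerNl -mulrN mulrC; exact: hge.
  have lam0 : 0 <= - complex.Re (lam k) by have [_ /ltW] := lamP k; rewrite -oppr_ge0.
  apply: (@le_trans _ _ ((\sum_(i < n.+1) p i * c i) `^ gamma)).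
    by apply: ge0_ler_powR => //; rewrite nnegrE//; apply: le_trans le1.
  apply: le_trans (powR_jensen g1 pc0 pS) _.
  rewrite (pcE (fun x => x `^ gamma)) lerD2l.
  have epsg : eps `^ gamma <= eps.
    rewrite -[leRHS](powRr1 (ltW eps0)); apply: ger_powR => //.
    by rewrite eps0 eps1.
  by apply: le_trans epsg; rewrite ler_piMl// powR_ge0.
apply: (@le_trans _ _ (\sum_(i < n) (- mu i) `^ gamma + d)%:E); last first.
  rewrite EFinD; apply: leeD => //; exact: eigenfamily_trace (ltW eps0) emu.
rewrite sumEFin lee_fin.
apply: le_trans (ler_sum _ (fun k _ => bound k)) _.
rewrite big_split/=; apply: lerD; last by rewrite sumr_const card_ord -mulr_natl.
(* For fixed i, Bessel's inequality for e_i in the orthonormal family u bounds the sum over k of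
   |<u_k, e_i>|^2 by 1. *)
rewrite exchange_big/=; apply: ler_sum => i _; rewrite -mulr_suml.
rewrite ler_piMl ?powR_ge0//.
have -> : 1 = re_ip ip (e i) (e i) by rewrite /re_ip on// eqxx.
rewrite (eq_bigr (fun k : 'I_N => normsq (ip (e i) (u k)))); first exact: (bessel ipP _ us.1).
by move=> k _; rewrite (ipC ipP) normsq_conj.
Qed.
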